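(* ($T_2$-Energy-Momentum-Casimir Method) Let $P$ be a finite-dimensional symplectic manifold with a free, proper, symplectic action of a Lie group $G$ with Lie algebra $\mathfrak g$ and an equivariant momentum map $J\colon P\to\mathfrak g^*$. Let $H$ be a smooth $G$-invariant Hamiltonian on $P$ and let $p_e$ be a relative equilibrium of $H$ with generator $\xi_e$ and momentum $\mu_e=J(p_e)$. Let $S$ be a slice to $Gp_e$ at $p_e$, let $\Sigma=J(S)$, and let $\{B_i\}_{i=1}^n$ be a smoothing of $T_2^S(p_e)$ at $p_e$. 1. If $\xi_e$ is a tame generator then $p_e$ is $G$-stable if for each $1\le i\le n$ there is a smooth local Casimir $C_i$ such that the Hessian $d^2\bigl((H+C_i\circ J)|B_i\bigr)(p_e)$ is definite on $T_{p_e}B_i$. 2. If $\xi_e$ is a very tame generator for the transverse Poisson structure on $\Sigma$ then $p_e$ is $G$-stable if for each $1\le i\le n$ there is a smooth local Casimir $C_i$ with a critical point at $\mu_e$ such that the Hessian $d^2\bigl(H_{\xi_e}+C_i\circ J\bigr)(p_e)$ is definite when restricted to $T_{p_e}B_i$.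
   Context: Definite means positive or negative definite. Equivariance of $J$: $J(gp)=\mathrm{Ad}^*_{g^{-1}}J(p)$. $X_H$ is the Hamiltonian vector field and $\Phi_t$ its flow. $p_e$ is a relative equilibrium with generator $\xi_e\in\mathfrak g$ if $X_H(p_e)=\xi_ep_e$ (infinitesimal action); equivalently $p_e$ is a critical point of $H_{\xi_e}=H-J_{\xi_e}$, where $J_{\xi_e}(p)=\langle J(p),\xi_e\rangle$. Then $\xi_e\in\mathfrak g_{\mu_e}$, the Lie algebra of the coadjoint isotropy group $G_{\mu_e}$. $p_e$ is $G$-stable if for every $G$-invariant neighbourhood $U$ of $p_e$ there is a neighbourhood $V$ of $p_e$ such that $\Phi_t(p)\in U$ for all $p\in V$ and all $t$. A slice to $Gp_e$ at $p_e$ is a submanifold $S$ through $p_e$ with $T_{p_e}P=T_{p_e}(Gp_e)\oplus T_{p_e}S$, small enough that it projects diffeomorphically onto an open neighbourhood of $Gp_e$ in the Poisson manifold $P/G$; $S$ carries the induced Poisson structure, whose symplectic leaves are the connected components of the sets $J^{-1}(\mathcal O)\cap S$, $\mathcal O$ a coadjoint orbit. $\Sigma=J(S)$ is a submanifold of $\mathfrak g^*$ through $\mu_e$ transverse to $G\mu_e$ and carries the induced transverse Poisson structure, whose symplectic leaves are the connected components of the intersections of $\Sigma$ with coadjoint orbits. $S$ is taken sufficiently small that $T_2^S(p_e)=J^{-1}(T_2^\Sigma(\mu_e))\cap S$. For a Poisson manifold $X$ with leaf space $Z$ (quotient topology) and quotient map $L\colon X\to Z$, $T_2^X(x)=L^{-1}(T_2(L(x)))$,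 where for a point $y$ of a topological space $Y$, $T_2(y)$ is the set of $y'\in Y$ such that every neighbourhood of $y$ meets every neighbourhood of $y'$. $T_2^S$ and $T_2^\Sigma$ are these sets for $X=S$ and $X=\Sigma$. For a subset $A$ of a manifold $M$ and $m\in A$: $T_mA$ is the set of derivatives $c'(0)$ of all $C^1$ curves $c$ in $M$ with $c(0)=m$ and $c(t)\in A$ for $t\ge0$. A smoothing of $A$ at $m$ is a finite collection of submanifolds $B_1,\dots,B_n\subseteq M$ (through $m$) such that $A\subseteq\bigcup_iB_i$ and $T_mB_i\subseteq\operatorname{span}(T_mA)$ for all $i$. Here $M=S$. The generator $\xi_e\in\mathfrak g_{\mu_e}$ is tame if it annihilates $T_{\mu_e}\bigl(T_2^\Sigma(\mu_e)\bigr)$, and very tame if $T_2^\Sigma(\mu_e)\subseteq\mu_e+\operatorname{ann}\xi_e$, where $\operatorname{ann}\xi_e=\{\nu:\langle\nu,\xi_e\rangle=0\}$. A local Casimir is a continuous function $C\colon U_{\mu_e}\to\mathbb R$ on a neighbourhood $U_{\mu_e}$ of $\mu_e$ in $\mathfrak g^*$ which is constant on the connected components of the coadjoint orbits intersected with $U_{\mu_e}$; one takes $S$ small enough that $\Sigma\subset U_{\mu_e}$. *)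

(* Defs.v *)
From HB Require Import structures.
From mathcomp Require Import all_boot all_order all_algebra.
From mathcomp Require Import all_classical all_reals all_analysis.

Set Implicit Arguments.
Unset Strict Implicit.
Unset Printing Implicit Defensive.

Import Order.TTheory GRing.Theory Num.Theory.
Import numFieldNormedType.Exports.

Local Open Scope classical_set_scope.
Local Open Scope ring_scope.

Section Calculus.
Context {R : realType}.

(* [U] is meant to be open. *)
Fixpoint Ck {V W : normedModType R} (k : nat) (f : V -> W) (U : set V) : Prop :=
  match k with
  | 0 => forall x, U x -> {for x, continuous f}
  | k'.+1 => (forall x, U x -> differentiable f x) /\
             forall v, Ck k' ('D_v f) U
  end.

Definition smooth_on {V W : normedModType R} (f : V -> W) (U : set V) :=
  forall k, Ck k f U.

Definition smooth_near {V W : normedModType R} (f : V -> W) (x : V) :=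
  exists2 U : set V, open_nbhs x U & smooth_on f U.

Definition quadratic_hessian {V : normedModType R} (f : V -> R) (x u : V) : R :=
  'D_u ('D_u f) x.

Definition definite_on {V : normedModType R} (T : set V) (Q : V -> R) :=
  (forall v, T v -> v != 0 -> 0 < Q v) \/ (forall v, T v -> v != 0 -> Q v < 0).

Definition linear_span {V : lmodType R} (A : set V) : set V :=
  [set v | exists (n : nat) (a : 'I_n -> R) (w : 'I_n -> V),
     (forall i, A (w i)) /\ v = \sum_(i < n) a i *: w i].

(* [tangent_set M A x] is T_x A for A included in the manifold M; M itself is
   a submanifold of the vector space V, so that C^1 curves in M are C^1 curves
   in V with values in M. *)
Definition tangent_set {V : normedModType R} (M A : set V) (x : V) : set V :=
  [set v | exists (c : R -> V) (e : R),
     [/\ 0 < e, Ck 1 c [set t | `|t| < e], c 0 = x &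
      [/\ (forall t, `|t| < e -> M (c t)),
          (forall t, 0 <= t < e -> A (c t)) &
          v = 'D_1 c 0]]].

(* [theta] is a diffeomorphism, with inverse [theta'], from a neighbourhood [U]
   of [x] onto an open set, which maps [A] to the first [k] coordinates. *)
Definition straightens n (k : nat) (A : set 'rV[R]_n) (x : 'rV[R]_n)
    (U : set 'rV[R]_n) (theta theta' : 'rV[R]_n -> 'rV[R]_n) :=
  [/\ open_nbhs x U /\ open (theta @` U),
      smooth_on theta U, smooth_on theta' (theta @` U),
      (forall y, U y -> theta' (theta y) = y) &
      forall y, U y ->
        (A y <-> forall i : 'I_n, (k <= i)%N -> theta y 0 i = 0)].

Definition straightenable n k (A : set 'rV[R]_n) (x : 'rV[R]_n) :=
  (k <= n)%N /\ exists U theta theta', straightens k A x U theta theta'.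

Definition vsubmanifold n (A : set 'rV[R]_n) :=
  exists k, forall x, A x -> straightenable k A x.

Definition pairing d (mu xi : 'rV[R]_d) : R := \sum_(i < d) mu 0 i * xi 0 i.

End Calculus.

(* The family of charts indexed by the points is an atlas, with [chart p] a
   chart around [p].  [chart p] and [chart_inv p] are meaningful only on
   [chart_dom p] and on its image.  The tangent space at [p] is 'rV[R]_n, a
   tangent vector being given by its coordinates in [chart p]. *)
Record manifold (R : realType) (n : nat) := Manifold {
  point_of :> topologicalType;
  chart_dom : point_of -> set point_of;
  chart : point_of -> point_of -> 'rV[R]_n;
  chart_inv : point_of -> 'rV[R]_n -> point_of;
  chart_dom_nbhs : forall p, open_nbhs p (chart_dom p);
  chart_img_open : forall p, open (chart p @` chart_dom p);
  chart_continuous : forall p q, chart_dom p q -> {for q, continuous (chart p)};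
  chart_inv_continuous : forall p x, (chart p @` chart_dom p) x ->
    {for x, continuous (chart_inv p)};
  chartK : forall p q, chart_dom p q -> chart_inv p (chart p q) = q;
  chart_compat : forall p q,
    smooth_on (chart q \o chart_inv p)
              (chart p @` (chart_dom p `&` chart_dom q));
  manifold_hausdorff : hausdorff_space point_of;
  manifold_second_countable : @second_countable point_of }.

Section Manifolds.
Context {R : realType}.

Definition smooth_function n (M : manifold R n) (W : normedModType R)
    (f : M -> W) :=
  forall p, smooth_near (f \o chart_inv p) (chart p p).

Definition smooth_map_at m n (M : manifold R m) (N : manifold R n)
    (f : M -> N) (p : M) :=
  {for p, continuous f} /\
  smooth_near (chart (f p) \o f \o chart_inv p) (chart p p).

Definition smooth_map2 l m n (L : manifold R l) (M : manifold R m)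
    (N : manifold R n) (f : L -> M -> N) :=
  forall p q,
    {for (p, q), continuous (fun z : L * M => f z.1 z.2)} /\
    smooth_near (fun x : 'rV[R]_l * 'rV[R]_m =>
                   chart (f p q) (f (chart_inv p x.1) (chart_inv q x.2)))
                (chart p p, chart q q).

Definition tangent_map m n (M : manifold R m) (N : manifold R n) (f : M -> N)
    (p : M) : 'rV[R]_m -> 'rV[R]_n :=
  'd (chart (f p) \o f \o chart_inv p) (chart p p).

Definition dfun n (M : manifold R n) (f : M -> R) (p : M) : 'rV[R]_n -> R :=
  'd (f \o chart_inv p) (chart p p).

Definition in_chart n (M : manifold R n) (p : M) (A : set M) : set 'rV[R]_n :=
  [set x | (chart p @` chart_dom p) x /\ A (chart_inv p x)].

Definition mtangent_set n (M : manifold R n) (X A : set M) (p : M) :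
    set 'rV[R]_n :=
  tangent_set (in_chart p X) (in_chart p A) (chart p p).

Definition submanifold n (M : manifold R n) (A : set M) :=
  exists k, forall p, A p -> straightenable k (in_chart p A) (chart p p).

Definition smoothing_at n (M : manifold R n) (X A : set M) (p : M)
    (N : nat) (B : 'I_N -> set M) :=
  [/\ forall i, [/\ submanifold (B i), B i `<=` X & B i p],
      A `<=` \bigcup_i B i &
      forall i, mtangent_set X (B i) p `<=` linear_span (mtangent_set X A p)].

(* Hessian at a critical point of the restriction to [A], computed in a chart
   of the submanifold [A]: the second derivative at [theta (chart p p)] along
   [u] only involves the values of [f] on [A]. *)
Definition restricted_hessian_definite n (M : manifold R n) (f : M -> R)
    (X A : set M) (p : M) :=
  exists k U theta theta',
    straightens k (in_chart p A) (chart p p) U theta theta' /\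
    definite_on (mtangent_set X A p) (fun v =>
      quadratic_hessian (f \o chart_inv p \o theta') (theta (chart p p))
        ('d theta (chart p p) v)).

(* Hessian at a critical point of [f], restricted to the tangent space of
   [A]. *)
Definition hessian_definite_on n (M : manifold R n) (f : M -> R)
    (X A : set M) (p : M) :=
  definite_on (mtangent_set X A p)
    (quadratic_hessian (f \o chart_inv p) (chart p p)).

(* The coordinate expression, in [chart p], of the 2-form [omega]. *)
Definition form_in_chart n (M : manifold R n)
    (omega : M -> 'rV[R]_n -> 'rV[R]_n -> R) (p : M) (x u v : 'rV[R]_n) : R :=
  let q := chart_inv p x in
  omega q ('d (chart q \o chart_inv p) x u) ('d (chart q \o chart_inv p) x v).

Record symplectic_form n (M : manifold R n)
    (omega : M -> 'rV[R]_n -> 'rV[R]_n -> R) : Prop := {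
  form_linear : forall p a u u' v,
    omega p (a *: u + u') v = a * omega p u v + omega p u' v;
  form_alternating : forall p u v, omega p u v = - omega p v u;
  form_nondegenerate : forall p u, (forall v, omega p u v = 0) -> u = 0;
  form_smooth : forall p u v,
    smooth_on (fun x => form_in_chart omega p x u v) (chart p @` chart_dom p);
  form_closed : forall p x u v w, (chart p @` chart_dom p) x ->
    'D_u (fun y => form_in_chart omega p y v w) x +
    'D_v (fun y => form_in_chart omega p y w u) x +
    'D_w (fun y => form_in_chart omega p y u v) x = 0 }.

(* Sign convention: omega (X_f, .) = df. *)
Definition hamiltonian_vf n (M : manifold R n)
    (omega : M -> 'rV[R]_n -> 'rV[R]_n -> R) (f : M -> R) (p : M) : 'rV[R]_n :=
  get [set X : 'rV[R]_n | forall v, omega p X v = dfun f p v].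

(* [flow X t p q] : the maximal flow of [X] is defined at time [t] at the point
   [p], and takes the value [q]. *)
Definition flow n (M : manifold R n) (X : M -> 'rV[R]_n) (t : R) (p q : M) :=
  exists (a b : R) (c : R -> M),
    [/\ a < 0 < b, a < t < b, c 0 = p, c t = q &
     forall s, a < s < b ->
       {for s, continuous c} /\
       is_derive s 1 (chart (c s) \o c : R -> 'rV[R]_n) (X (c s))].

End Manifolds.

Record lieGroup (R : realType) (d : nat) := LieGroup {
  lie_manifold :> manifold R d;
  lmul : lie_manifold -> lie_manifold -> lie_manifold;
  linv : lie_manifold -> lie_manifold;
  lone : lie_manifold;
  lmulA : associative lmul;
  lmul1 : left_id lone lmul;
  lmulV : left_inverse lone linv lmul;
  lmul_smooth : smooth_map2 lmul;
  linv_smooth : forall g, smooth_map_at linv g }.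

(* The Lie algebra is the tangent space 'rV[R]_d at the identity, and its dual
   is identified with 'rV[R]_d by [pairing]. *)
Section LieGroups.
Context {R : realType} {d : nat} (G : lieGroup R d).

Definition Ad (g : G) : 'rV[R]_d -> 'rV[R]_d :=
  tangent_map (fun h : G => lmul (lmul g h) (linv g)) (lone G).

(* Ad^*_{g^-1} mu, the linear form xi |-> <mu, Ad_{g^-1} xi>. *)
Definition coAd (g : G) (mu : 'rV[R]_d) : 'rV[R]_d :=
  \row_i pairing mu (Ad (linv g) (delta_mx 0 i)).

Definition coadjoint_orbit (mu : 'rV[R]_d) : set 'rV[R]_d :=
  [set coAd g mu | g in [set: G]].

Definition joined_in (T : topologicalType) (A : set T) (x y : T) :=
  exists c : R -> T,
    [/\ {within `[0, 1], continuous c}, c 0 = x, c 1 = y &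
        forall t, 0 <= t <= 1 -> A (c t)].

(* [x] and [y] belong to the same connected component of the intersection of
   [X] with [F @^-1` O], for a coadjoint orbit O.  Orbits are in general only
   immersed, so that connected components are those for the orbit topology and
   not for the topology induced by the ambient space: e.g. an intersection may
   be dense in X while consisting of infinitely many leaves.  As orbits are
   initial submanifolds, a path is continuous into the orbit as soon as it is
   continuous into the ambient space, and these components are the path
   components for the induced topology. *)
Definition same_leaf (T : topologicalType) (F : T -> 'rV[R]_d) (X : set T)
    (x y : T) :=
  joined_in (X `&` F @^-1` coadjoint_orbit (F x)) x y.

(* Inverse images by X -> Z of the open sets of the leaf space Z. *)
Definition leaf_open (T : topologicalType) (F : T -> 'rV[R]_d) (X W : set T) :=
  (exists2 O, open O & W = X `&` O) /\
  forall x y, W x -> X y -> same_leaf F X x y -> W y.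

(* T_2^X(x), for [X] partitioned into the leaves given by [same_leaf F X]. *)
Definition T2 (T : topologicalType) (F : T -> 'rV[R]_d) (X : set T) (x : T) :
    set T :=
  [set y | X y /\ forall W W', leaf_open F X W -> leaf_open F X W' ->
     W x -> W' y -> W `&` W' !=set0].

Record smooth_local_casimir (mu : 'rV[R]_d) (U : set 'rV[R]_d)
    (C : 'rV[R]_d -> R) : Prop := {
  casimir_nbhs : open_nbhs mu U;
  casimir_continuous : forall nu, U nu -> {for nu, continuous C};
  casimir_leaf : forall nu nu', U nu -> U nu' ->
    same_leaf id U nu nu' -> C nu = C nu';
  casimir_smooth : smooth_on C U }.

Definition tame (Sigma : set 'rV[R]_d) (mu xi : 'rV[R]_d) :=
  forall nu, tangent_set Sigma (T2 id Sigma mu) mu nu -> pairing nu xi = 0.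

Definition very_tame (Sigma : set 'rV[R]_d) (mu xi : 'rV[R]_d) :=
  forall nu, T2 id Sigma mu nu -> pairing (nu - mu) xi = 0.

Context {n : nat} {P : manifold R n} (act : G -> P -> P).

Record lie_action : Prop := {
  act_smooth : smooth_map2 act;
  act1 : forall p, act (lone G) p = p;
  actM : forall g h p, act (lmul g h) p = act g (act h p) }.

Definition free_action := forall g p, act g p = p -> g = lone G.

Definition proper_action := forall K : set (P * P), compact K ->
  compact ((fun z : G * P => (z.2, act z.1 z.2)) @^-1` K).

Definition symplectic_action (omega : P -> 'rV[R]_n -> 'rV[R]_n -> R) :=
  forall g p u v,
    omega (act g p) (tangent_map (act g) p u) (tangent_map (act g) p v)
    = omega p u v.

(* The vector xi p. *)
Definition infinitesimal_action (xi : 'rV[R]_d) (p : P) : 'rV[R]_n :=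
  tangent_map (act^~ p) (lone G) xi.

Definition J_along (J : P -> 'rV[R]_d) (xi : 'rV[R]_d) (p : P) : R :=
  pairing (J p) xi.

Record equivariant_momentum_map (omega : P -> 'rV[R]_n -> 'rV[R]_n -> R)
    (J : P -> 'rV[R]_d) : Prop := {
  momentum_smooth : smooth_function J;
  momentum_hamiltonian : forall xi p v,
    omega p (infinitesimal_action xi p) v = dfun (J_along J xi) p v;
  momentum_equivariant : forall g p, J (act g p) = coAd g (J p) }.

Definition invariant_function (f : P -> R) := forall g p, f (act g p) = f p.

Definition relative_equilibrium (omega : P -> 'rV[R]_n -> 'rV[R]_n -> R)
    (H : P -> R) (p : P) (xi : 'rV[R]_d) :=
  hamiltonian_vf omega H p = infinitesimal_action xi p.

Definition G_stable (omega : P -> 'rV[R]_n -> 'rV[R]_n -> R)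
    (H : P -> R) (p_e : P) :=
  forall U : set P, nbhs p_e U -> (forall g p, U p -> U (act g p)) ->
  exists2 V : set P, nbhs p_e V &
    forall p t q, V p -> flow (hamiltonian_vf omega H) t p q -> U q.

Definition group_orbit (p : P) : set P := [set act g p | g in [set: G]].

Definition saturation (S : set P) : set P :=
  [set act g s | g in [set: G] & s in S].

(* [r] induces the inverse of the projection of S onto its image in P/G, as a
   map on an open subset of P/G is smooth iff its composition with P -> P/G
   is. *)
Record slice (S : set P) (p : P) : Prop := {
  slice_submanifold : submanifold S;
  slice_mem : S p;
  slice_sum : forall v, exists a b,
    [/\ mtangent_set setT (group_orbit p) p a, mtangent_set setT S p b
      & v = a + b];
  slice_direct : mtangent_set setT (group_orbit p) p `&` mtangent_set setT S p
    `<=` [set 0];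
  slice_open : open (saturation S);
  slice_projection : exists r : P -> P,
    (forall g s, S s -> r (act g s) = s) /\
    forall q, saturation S q -> smooth_map_at r q }.

Definition orbit_transversal (Sigma : set 'rV[R]_d) (mu : 'rV[R]_d) :=
  [/\ vsubmanifold Sigma, Sigma mu &
      forall nu, exists a b,
        [/\ tangent_set setT (coadjoint_orbit mu) mu a,
            tangent_set setT Sigma mu b & nu = a + b]].

End LieGroups.

(* Main.v *)
Require Import Defs.
From mathcomp Require Import all_boot all_order all_algebra.
From mathcomp Require Import all_classical all_reals all_analysis.
Import Order.TTheory GRing.Theory Num.Theory.
Import numFieldNormedType.Exports.
Set Implicit Arguments.
Unset Strict Implicit.
Unset Printing Implicit Defensive.

Local Open Scope classical_set_scope.
Local Open Scope ring_scope.

(** A trajectory projects to the slice [S] by moving each of its points with a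
    group element. The Hamiltonian is unchanged by this, and by Noether's
    theorem and equivariance the momentum stays in one coadjoint orbit: the
    projected trajectory stays in one leaf of [S] and on one level set of [H].
    If trajectories starting arbitrarily close to [p_e] reached a fixed small
    compact sphere around [p_e] in [S], they would accumulate there at a point
    [y]. No two leaf-saturated open sets separate [y] from [p_e], so [y] is in
    [T2], and [H y = H p_e] by continuity. Hence [p_e] is [G]-stable as soon as
    it is, locally, the only point of [T2] at its level of [H]; this is
    [stable_of_isolated]. Properness of the action ensures that a trajectory can
    leave the tube over a compact part of the slice only through that sphere
    ([proper_saturation_closed], [first_exit]). The accumulation argument is
    phrased as a covering argument: each point of the sphere is separated from
    [p_e] ([leaf_separated]), hence so is the whole sphere.

    It remains to isolate [p_e] on each member [B i] of the smoothing, which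
    together cover [T2]. A Casimir is continuous and constant on leaves, hence
    constant on [T2] ([casimir_T2]), so [H] may be replaced there by
    [H + C o J], and in the very tame case by [H_xi + C o J] since [J_xi] is
    constant on [T2] too. These functions are critical at [p_e] along [B i]:
    in the tame case because [dH = dJ_xi] at the relative equilibrium and both
    [J_xi] and [C o J] have zero derivative along curves in [T2]
    ([tame_isolated]), in the very tame case because [H_xi] and [C] are critical
    ([very_tame_isolated]). The definite Hessian then makes [p_e] a strict local
    extremum on [B i], by the second derivative test in straightening
    coordinates ([strict_local_min], [straightened_isolated],
    [critical_isolated]). *)

(** * Calculus on normed spaces *)

Section NearDiff.
Context {R : realType} {V W : normedModType R}.

Lemma near_eq_diff_locally (f g : V -> W) (x : V) :
  (\forall y \near x, f y = g y) -> differentiable f x ->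
  g \o shift x = cst (g x) + 'd f x +o_ 0 id.
Proof.
move=> fg df; have fgx : f x = g x by exact: nbhs_singleton fg.
apply/eqaddoP => e e0.
have /eqaddoP/(_ e e0) := diff_locally df.
have fg0 : \forall h \near (0 : V), f (h + x) = g (h + x).
  by move: fg; rewrite (near_shift 0) subr0.
by move=> H; near=> h; rewrite /= !fctE /= -fgx -(near fg0 h)//; near: h.
Unshelve. all: by end_near. Qed.

Lemma near_eq_diff (f g : V -> W) (x : V) :
  (\forall y \near x, f y = g y) -> differentiable f x ->
  'd g x = 'd f x :> (V -> W).
Proof.
move=> fg df; apply: diff_unique; last exact: near_eq_diff_locally.
have /diff_locallyP[] := df; exact.
Qed.

Lemma near_eq_differentiable (f g : V -> W) (x : V) :
  (\forall y \near x, f y = g y) -> differentiable f x -> differentiable g x.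
Proof.
move=> fg df; apply/diff_locallyP; rewrite (near_eq_diff fg df).
by split; [exact: diff_continuous|exact: near_eq_diff_locally].
Qed.

End NearDiff.

Lemma near_open_eq {T : topologicalType} {W : Type} (U : set T) (f g : T -> W) x :
  open U -> (forall y, U y -> f y = g y) -> U x -> \forall y \near x, f y = g y.
Proof. by move=> oU fg Ux; apply: filterS fg _; exact: open_nbhs_nbhs. Qed.

Section CkTheory.
Context {R : realType}.
Implicit Types (V W : normedModType R).

Lemma Ck_eq V W k (f g : V -> W) (U : set V) : open U ->
  (forall x, U x -> f x = g x) -> Ck k f U -> Ck k g U.
Proof.
move=> oU; elim: k f g => [|k IH] f g fg /=.
  move=> cf x Ux; have := cf x Ux; rewrite /prop_for /continuous_at -(fg x Ux).
  apply: cvg_trans; apply: near_eq_cvg; exact: near_open_eq oU fg Ux.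
move=> [df dDf]; split.
  by move=> x Ux; exact: near_eq_differentiable (near_open_eq oU fg Ux) (df x Ux).
move=> v; apply: IH (dDf v) => x Ux.
exact: near_eq_derive (near_open_eq oU fg Ux).
Qed.

Lemma Ck_sub V W k (f : V -> W) (U U' : set V) :
  U' `<=` U -> Ck k f U -> Ck k f U'.
Proof.
move=> UU; elim: k f => [|k IH] f /=; first by move=> cf x /UU; exact: cf.
by move=> [df dD]; split=> [x /UU|v]; [exact: df|exact: IH].
Qed.

Lemma CkW V W k (f : V -> W) (U : set V) : Ck k.+1 f U -> Ck k f U.
Proof.
elim: k f => [|k IH] f [df dD]; last by split=> // v; exact: IH.
by move=> x Ux; apply: differentiable_continuous; exact: df.
Qed.

Lemma Ck_continuous V W k (f : V -> W) (U : set V) x :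
  Ck k f U -> U x -> {for x, continuous f}.
Proof. by elim: k => [|k IH]; [exact|move/CkW; exact: IH]. Qed.

Lemma Ck_cst V W k (a : W) (U : set V) : Ck k (cst a) U.
Proof.
elim: k a => [|k IH] a; first by move=> x _; exact: cvg_cst.
split=> [x _|v]; first exact: differentiable_cst.
have -> : 'D_v (cst a : V -> W) = cst 0 by apply/funext => x; exact: derive_cst.
exact: IH.
Qed.

Lemma Ck_add V W k (f g : V -> W) (U : set V) : open U ->
  Ck k f U -> Ck k g U -> Ck k (fun x => f x + g x) U.
Proof.
move=> oU; elim: k f g => [|k IH] f g.
  by move=> cf cg x Ux; exact: cvgD (cf x Ux) (cg x Ux).
move=> [df dDf] [dg dDg]; split=> [x Ux|v].
  exact: differentiableD (df x Ux) (dg x Ux).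
apply: Ck_eq (IH _ _ (dDf v) (dDg v)) => // x Ux.
by rewrite [RHS]deriveD//; apply: diff_derivable; [exact: df|exact: dg].
Qed.

Lemma Ck_mul V k (f g : V -> R) (U : set V) : open U ->
  Ck k f U -> Ck k g U -> Ck k (fun x => f x * g x) U.
Proof.
move=> oU; elim: k f g => [|k IH] f g.
  by move=> cf cg x Ux; exact: cvgM (cf x Ux) (cg x Ux).
move=> Cf Cg; have [[df dDf] [dg dDg]] := (Cf, Cg); split=> [x Ux|v].
  exact: differentiableM (df x Ux) (dg x Ux).
apply: Ck_eq (Ck_add oU (IH _ _ (CkW Cf) (dDg v)) (IH _ _ (CkW Cg) (dDf v))) => //.
by move=> x Ux; rewrite [RHS]deriveM//; apply: diff_derivable; [exact: df|exact: dg].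
Qed.

Lemma Ck_sum V W k m (f : 'I_m -> V -> W) (U : set V) : open U ->
  (forall i, Ck k (f i) U) -> Ck k (fun x => \sum_(i < m) f i x) U.
Proof.
move=> oU; elim: m f => [|m IH] f Cf.
  by apply: Ck_eq (Ck_cst k 0 U) => // x _; rewrite big_ord0.
apply: Ck_eq (Ck_add oU (IH _ (fun i => Cf (widen_ord (leqnSn m) i))) (Cf ord_max)).
  exact: oU.
by move=> x _; rewrite big_ord_recr.
Qed.

Lemma derive_coord V m (g : V -> 'rV[R]_m) x v i : derivable g x v ->
  'D_v (fun y => g y 0 i) x = ('D_v g x) 0 i.
Proof. by move=> dg; rewrite (derive_mx dg) mxE. Qed.

Lemma differentiable_comp_coord V m (g : V -> 'rV[R]_m) x i :
  differentiable g x -> differentiable (fun y => g y 0 i) x.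
Proof.
move=> dg; exact: (differentiable_comp dg (differentiable_coord _ 0 i)).
Qed.

Lemma Ck_coord V m k (g : V -> 'rV[R]_m) (U : set V) i : open U ->
  Ck k g U -> Ck k (fun y => g y 0 i) U.
Proof.
move=> oU; elim: k g => [|k IH] g.
  move=> cg x Ux.
  apply: (@continuous_comp _ _ _ g (fun N : 'rV[R]_m => N 0 i)).
    exact: cg.
  exact: coord_continuous.
move=> [dg dD]; split=> [x Ux|v].
  by apply: differentiable_comp_coord; exact: dg.
apply: Ck_eq (IH _ (dD v)) => // x Ux; rewrite derive_coord//.
by apply: diff_derivable; exact: dg.
Qed.

(** The chain rule in coordinates: it only involves the partial derivatives of
    the outer function, which makes it suited to an induction on the order of
    differentiability. *)
Lemma derive_comp_coord V W m (g : V -> 'rV[R]_m) (f : 'rV[R]_m -> W) x v :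
  differentiable g x -> differentiable f (g x) ->
  'D_v (f \o g) x =
  \sum_(i < m) ('D_v g x) 0 i *: 'D_(delta_mx 0 i) f (g x).
Proof.
move=> dg df; rewrite deriveE; last exact: differentiable_comp.
rewrite diff_comp//= -(deriveE _ dg) {1}(row_sum_delta ('D_v g x)) linear_sum.
by apply: eq_bigr => i _; rewrite linearZ_LR (deriveE _ df).
Qed.

Lemma Ck_comp V m k (g : V -> 'rV[R]_m) (f : 'rV[R]_m -> R)
    (U : set V) (O : set 'rV[R]_m) : open U -> (forall x, U x -> O (g x)) ->
  Ck k g U -> Ck k f O -> Ck k (f \o g) U.
Proof.
move=> oU UO; elim: k f => [|k IH] f Cg Cf.
  by move=> x Ux; apply: continuous_comp; [exact: Cg|exact: Cf (UO x Ux)].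
have [[dg dDg] [df dDf]] := (Cg, Cf); split=> [x Ux|v].
  by apply: differentiable_comp; [exact: dg|exact/df/UO].
pose h i x := ('D_v g x) 0 i * ('D_(delta_mx 0 i) f \o g) x.
have Ch i : Ck k (h i) U.
  exact: Ck_mul oU (Ck_coord _ oU (dDg v)) (IH _ (CkW Cg) (dDf _)).
apply: Ck_eq (Ck_sum oU Ch) => // x Ux.
by rewrite derive_comp_coord//; [exact: dg|exact/df/UO].
Qed.

(** Unlike [Ck_comp] this needs no product rule, so the outer function may take
    values in any normed space; it is applied to the image of a curve under the
    momentum map. *)
Lemma C1_comp V W m (g : V -> 'rV[R]_m) (f : 'rV[R]_m -> W)
    (U : set V) (O : set 'rV[R]_m) : open U -> (forall x, U x -> O (g x)) ->
  Ck 1 g U -> Ck 1 f O -> Ck 1 (f \o g) U.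
Proof.
move=> oU UO [dg dDg] [df dDf]; split=> [x Ux|v].
  by apply: differentiable_comp; [exact: dg|exact/df/UO].
pose h i x := ('D_v g x) 0 i *: ('D_(delta_mx 0 i) f \o g) x.
have Ch i : Ck 0 (h i) U.
  move=> x Ux; apply: cvgZ.
    exact: (@Ck_coord _ _ 0 _ _ i oU (dDg v) x Ux).
  apply: continuous_comp; last exact/dDf/UO.
  by apply: differentiable_continuous; exact: dg.
apply: Ck_eq (Ck_sum oU Ch) => // x Ux.
by rewrite derive_comp_coord//; [exact: dg|exact/df/UO].
Qed.

End CkTheory.

(** * The second derivative test on a cone *)

Section SecondDerivativeTest.
Context {R : realType}.

Lemma continuous_within (T U : topologicalType) (A : set T) (f : T -> U) :
  (forall x, A x -> {for x, continuous f}) -> {within A, continuous f}.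
Proof.
by move=> cf; apply/subspace_continuousP => x /cf; exact: cvg_within_filter.
Qed.

Lemma derive_dir (W : normedModType R) m (f : 'rV[R]_m -> W) x u :
  differentiable f x ->
  'D_u f x = \sum_(i < m) u 0 i *: 'D_(delta_mx 0 i) f x.
Proof.
move=> df; rewrite (deriveE _ df) {1}(row_sum_delta u) linear_sum.
by apply: eq_bigr => i _; rewrite linearZ_LR (deriveE _ df).
Qed.

(** Expanding both directions turns the Hessian into a quadratic polynomial in
    the direction with continuous coefficients, whence its joint continuity in
    base point and direction below. *)
Lemma derive_derive_dir m (f : 'rV[R]_m -> R) (U : set 'rV[R]_m) x u v :
  open U -> Ck 2 f U -> U x ->
  'D_u ('D_v f) x = \sum_(i < m) v 0 i * 'D_u ('D_(delta_mx 0 i) f) x.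
Proof.
move=> oU [df dDf] Ux.
rewrite (@near_eq_derive _ _ _ ('D_v f)
  (\sum_(i < m) (v 0 i *: 'D_(delta_mx 0 i) f)) x u); last first.
  apply: (near_open_eq oU _ Ux) => y Uy.
  by rewrite (derive_dir _ (df y Uy)) fct_sumE.
have dD i : derivable ('D_(delta_mx 0 i) f) x u.
  by apply: diff_derivable; exact: (dDf _).1.
rewrite derive_sum => [|i]; last exact: derivableZ.
by apply: eq_bigr => i _; rewrite deriveZ.
Qed.

Lemma hessian_near_continuous m (f : 'rV[R]_m -> R) (U : set 'rV[R]_m) a u :
  open_nbhs a U -> Ck 2 f U -> 0 < 'D_u ('D_u f) a ->
  \forall v \near u & x \near a, 0 < 'D_v ('D_v f) x.
Proof.
move=> [oU Ua] Cf Hu.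
pose D i j := 'D_(delta_mx 0 j) ('D_(delta_mx 0 i) f).
pose Q (z : 'rV[R]_m * 'rV[R]_m) :=
  \sum_(i < m) z.1 0 i * \sum_(j < m) z.1 0 j * D i j z.2.
have QE x v : U x -> Q (v, x) = 'D_v ('D_v f) x.
  move=> Ux; rewrite (derive_derive_dir v v oU Cf Ux); apply: eq_bigr => i _.
  congr (_ * _); have [_ /(_ (delta_mx 0 i)) [dD _]] := Cf.
  by rewrite (derive_dir _ (dD x Ux)).
have cQ : {for (u, a), continuous Q}.
  have cc i : {for (u, a), continuous (fun z : 'rV[R]_m * 'rV[R]_m => z.1 0 i)}.
    apply: (@continuous_comp _ _ _ fst (fun N : 'rV[R]_m => N 0 i)).
      exact: cvg_fst.
    exact: coord_continuous.
  apply: cvg_big => [|i _]; first exact: add_continuous.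
  apply: cvgM; first exact: cc.
  apply: cvg_big => [|j _]; first exact: add_continuous.
  apply: cvgM; first exact: cc.
  apply: (@continuous_comp _ _ _ snd (D i j)); first exact: cvg_snd.
  by have [_ /(_ (delta_mx 0 i)) [_ /(_ (delta_mx 0 j))]] := Cf; exact.
have Qpos : \forall z \near (u, a), 0 < Q z.
  by apply: (cvgr_gt _ cQ); rewrite QE.
have [[/= A B] [nA nB] AB] := Qpos.
exists (A, B `&` U) => [|[v x] /= [Av [Bx Ux]]].
  by split=> //=; apply: filterI => //; exact: open_nbhs_nbhs.
by rewrite -QE//; exact: (AB (v, x)).
Qed.

Lemma is_derive_line (V W : normedModType R) (f : V -> W) (a u : V) (t : R) :
  differentiable f (a + t *: u) ->
  is_derive t 1 (fun s => f (a + s *: u)) ('D_u f (a + t *: u)).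
Proof.
move=> df; pose l := fun s : R => a + s *: u.
have dl : is_diff t l (0 + *:%R^~ u).
  by apply: is_diffD; exact: is_diff_scalel.
have dlt : differentiable l t by exact: ex_diff.
have dfl : differentiable f (l t) by [].
apply: DeriveDef; first exact: diff_derivable (differentiable_comp dlt dfl).
rewrite (deriveE _ (differentiable_comp dlt dfl)) (diff_comp dlt dfl) /=.
by rewrite (@diff_val _ _ _ _ _ _ _ dl) /= !fctE add0r scale1r deriveE.
Qed.

Lemma mvt0 (g dg : R -> R) (s : R) : 0 < s ->
  (forall t, 0 <= t <= s -> is_derive t 1 g (dg t)) ->
  exists2 c, 0 < c < s & g s - g 0 = dg c * s.
Proof.
move=> s0 dgP; have [||c] := @MVT R g dg 0 s s0.
- move=> x; rewrite in_itv /= => /andP[x0 xs]; apply: dgP.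
  by rewrite !ltW.
- apply: continuous_within => x /=; rewrite in_itv /= => /dgP[dx _].
  exact/differentiable_continuous/derivable1_diffP.
- by rewrite in_itv /= subr0; exists c.
Qed.

Lemma norm_sphere_compact m (T : set 'rV[R]_m) :
  closed T -> compact (T `&` [set u | `|u| = 1]).
Proof.
move=> cT; apply: bounded_closed_compact.
  exists 1; split; first exact: num_real.
  by move=> M M1 u [_ /= ->]; exact: ltW.
apply: closedI => //; apply: (@preimage_closed _ _ (@Num.norm _ 'rV[R]_m) [set 1]).
  by move=> x _; exact: norm_continuous.
exact: closed_eq.
Qed.

(** Positivity of the Hessian at [a] persists on a neighbourhood of [a],
    uniformly over the compact unit sphere of the cone; along each ray of the
    cone the function is then strictly convex with vanishing initial slope. *)
Lemma strict_local_min m (f : 'rV[R]_m -> R) (U T : set 'rV[R]_m) a :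
  open_nbhs a U -> Ck 2 f U ->
  closed T -> (forall c u, T u -> T (c *: u)) ->
  (forall u, T u -> 'D_u f a = 0) ->
  (forall u, T u -> u != 0 -> 0 < 'D_u ('D_u f) a) ->
  \forall z \near a, T (z - a) -> z != a -> f a < f z.
Proof.
move=> aU Cf cT sT crit Hpos; have [oU Ua] := aU.
have nearpos : \forall x \near a, (T `&` [set u | `|u| = 1]) `<=`
    (fun u => 0 < 'D_u ('D_u f) x).
  have /compact_near_coveringP/near_covering_withinP cov :=
    norm_sphere_compact cT.
  apply: (cov _ (nbhs a) (fun x u => 0 < 'D_u ('D_u f) x)) => u [Tu /= u1].
  have := hessian_near_continuous aU Cf (Hpos u Tu _).
  rewrite -normr_gt0 u1 ltr01 => /(_ isT) H.
  by apply: filterS H => z; exact.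
have [r /= r0 ballr] : nbhs_ball a (fun x => U x /\
    (T `&` [set u | `|u| = 1]) `<=` (fun u => 0 < 'D_u ('D_u f) x)).
  apply/nbhs_ballP; apply: filterI nearpos; exact: open_nbhs_nbhs.
apply: filterS (nbhsx_ballx a r r0) => z; rewrite -ball_normE /= => zr Tz za.
pose s := `|z - a|; pose u := s^-1 *: (z - a).
have s0 : 0 < s by rewrite normr_gt0 subr_eq0.
have u1 : `|u| = 1 by rewrite normrZ gtr0_norm ?invr_gt0// mulVf// gt_eqF.
have Tu : T u by exact: sT.
have line t : 0 <= t <= s -> U (a + t *: u) /\ 0 < 'D_u ('D_u f) (a + t *: u).
  move=> /andP[t0 ts]; have [|? H] := ballr (a + t *: u).
    rewrite -ball_normE /= opprD addrA subrr sub0r normrN normrZ u1 mulr1.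
    by rewrite ger0_norm// (le_lt_trans ts)// /s distrC.
  by split=> //; exact: H.
have zE : z = a + s *: u by rewrite scalerA divff ?gt_eqF// scale1r addrC subrK.
(* The mean value theorem, applied twice along the segment from [a] to [z]. *)
have [c /andP[c0 cs]] := @mvt0 (fun t => f (a + t *: u)) _ s s0
  (fun t ts => is_derive_line (Cf.1 _ (line t ts).1)).
have [|e /andP[e0 ec]] := @mvt0 (fun t => 'D_u f (a + t *: u))
    (fun t => 'D_u ('D_u f) (a + t *: u)) c c0.
  move=> t /andP[t0 tc]; apply: is_derive_line; apply: (Cf.2 u).1.
  by apply: (line t _).1; rewrite t0 (le_trans tc) ?ltW.
rewrite scale0r addr0 crit// subr0 => ->.
rewrite -zE => /eqP; rewrite subr_eq => /eqP ->; rewrite ltrDr mulr_gt0// mulr_gt0//.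
by apply: (line e _).2; rewrite (ltW e0) (ltW (lt_trans ec cs)).
Qed.

End SecondDerivativeTest.

(** * Isolated level points on submanifolds *)

Section Isolated.
Context {R : realType}.

Lemma open_setI_preimage (T U : topologicalType) (f : T -> U) (D : set T) (O : set U) :
  open D -> open O -> (forall x, D x -> {for x, continuous f}) ->
  open (D `&` f @^-1` O).
Proof.
move=> oD oO cf; rewrite openE => x [Dx Ofx]; apply: filterI.
  exact: open_nbhs_nbhs.
by apply: (cf x Dx); exact: open_nbhs_nbhs.
Qed.

Lemma definite_isolated m (f : 'rV[R]_m -> R) (U T : set 'rV[R]_m) a :
  open_nbhs a U -> Ck 2 f U ->
  closed T -> (forall c u, T u -> T (c *: u)) ->
  (forall u, T u -> 'D_u f a = 0) ->
  definite_on T (quadratic_hessian f a) ->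
  \forall z \near a, T (z - a) -> f z = f a -> z = a.
Proof.
move=> aU Cf cT sT crit [pos|neg].
  apply: filterS (strict_local_min aU Cf cT sT crit pos) => z zmin Tz fz.
  by apply/eqP; apply: contraT => /(zmin Tz); rewrite fz ltxx.
have [oU Ua] := aU.
pose g x := -1 * f x.
have Cg : Ck 2 g U by exact: Ck_mul oU (Ck_cst _ _ _) Cf.
have Dg u x : U x -> 'D_u g x = - 'D_u f x.
  move=> Ux; rewrite -deriveN; last by apply: diff_derivable; exact: Cf.1.
  by apply: near_eq_derive; apply: filterE => y; rewrite /g mulN1r.
have DDg u : 'D_u ('D_u g) a = - 'D_u ('D_u f) a.
  rewrite -deriveN; last by apply: diff_derivable; exact: (Cf.2 u).1.
  by apply: near_eq_derive; apply: (near_open_eq oU _ Ua) => y /Dg.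
have := @strict_local_min _ _ g U T a aU Cg cT sT.
move=> H; have {}H : \forall z \near a, T (z - a) -> z != a -> g a < g z.
  apply: H => [u Tu|u Tu u0]; first by rewrite Dg// crit// oppr0.
  by rewrite DDg oppr_gt0; exact: neg.
apply: filterS H => z zmin Tz fz.
by apply/eqP; apply: contraT => /(zmin Tz); rewrite /g fz ltxx.
Qed.

Lemma diff_left_inverse (V W : normedModType R) (f : V -> W) (g : W -> V) x v :
  differentiable f x -> differentiable g (f x) ->
  (\forall y \near x, g (f y) = y) -> 'd g (f x) ('d f x v) = v.
Proof.
move=> df dg gf.
have -> : 'd g (f x) ('d f x v) = 'd (g \o f) x v.
  by rewrite (diff_comp df dg).
have fgid : \forall y \near x, id y = (g \o f) y by apply: filterS gf => y /= ->.
rewrite (near_eq_diff fgid); last exact: ex_diff.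
by rewrite (@diff_val _ _ _ _ _ _ _ (is_diff_id x)).
Qed.

Definition coord_plane m k : set 'rV[R]_m :=
  [set u | forall i : 'I_m, (k <= i)%N -> u 0 i = 0].

Lemma coord_plane_closed m k : closed (@coord_plane m k).
Proof.
have -> : @coord_plane m k =
    \bigcap_(i in [set i : 'I_m | (k <= i)%N]) [set u : 'rV[R]_m | u 0 i = 0].
  by apply/seteqP; split=> u; exact.
apply: closed_bigI => i _.
apply: (@preimage_closed _ _ (fun u : 'rV[R]_m => u 0 i) [set 0]).
  by move=> u _; exact: coord_continuous.
exact: closed_eq.
Qed.

Lemma Ck1_line (W : normedModType R) (a u : W) (U : set R) :
  Ck 1 (fun t : R => a + t *: u) U.
Proof.
have dl t : is_diff t (fun t : R => a + t *: u) (0 + *:%R^~ u).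
  by apply: is_diffD; exact: is_diff_scalel.
split=> [t _|v t _]; first exact: ex_diff.
have -> : 'D_v (fun t : R => a + t *: u) = cst (v *: u).
  apply/funext => s; rewrite deriveE; last exact: ex_diff.
  by rewrite (@diff_val _ _ _ _ _ _ _ (dl s)) /= !fctE add0r.
exact: cvg_cst.
Qed.

Lemma straightens_inverse_point m k (A : set 'rV[R]_m) x U theta theta' z :
  straightens k A x U theta theta' -> (theta @` U) z ->
  U (theta' z) /\ theta (theta' z) = z.
Proof. by move=> [_ _ _ inv _] [y Uy <-]; rewrite inv. Qed.

Lemma straightens_domain m k (A : set 'rV[R]_m) x U theta theta' D :
  straightens k A x U theta theta' -> open D -> D x ->
  exists V, [/\ open_nbhs (theta x) V, (forall z, V z -> D (theta' z)) &
    smooth_on theta' V].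
Proof.
move=> [[[oU Ux] oV] _ Cth' inv _] oD Dx.
exists ((theta @` U) `&` theta' @^-1` D); split.
- split; last by split; [exists x|rewrite /= inv].
  apply: (open_setI_preimage oV oD); exact: (Cth' 0%N).
- by move=> z [].
- move=> j; apply: (Ck_sub _ (Cth' j)); exact: subIsetl.
Qed.

(** In straightening coordinates, the affine line through the image of [x] in
    a direction of the coordinate plane pulls back to a curve in [A]. *)
Lemma straightens_tangent m k (M A : set 'rV[R]_m) x U theta theta' u :
  straightens k A x U theta theta' -> A `<=` M -> A x -> coord_plane k u ->
  tangent_set M A x ('d theta' (theta x) u).
Proof.
move=> st AM Ax ku; have [[[oU Ux] oV] Cth Cth' inv AE] := st.
set a := theta x; have Va : (theta @` U) a by exists x.
have [r /= r0 ballr] : nbhs_ball (0 : R) (fun t => (theta @` U) (a + t *: u)).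
  apply/nbhs_ballP.
  have cl : {for (0 : R), continuous (fun t : R => a + t *: u)}.
    exact: (Ck_continuous (@Ck1_line _ a u setT)).
  by apply: cl; rewrite scale0r addr0; exact: open_nbhs_nbhs.
have Vline t : `|t| < r -> (theta @` U) (a + t *: u).
  by move=> tr; apply: ballr; rewrite -ball_normE /= sub0r normrN.
have Aline t : `|t| < r -> A (theta' (a + t *: u)).
  move=> /Vline V; have [Uy yE] := straightens_inverse_point st V.
  apply/(AE _ Uy) => i ki; rewrite yE !mxE (ku i ki) mulr0 addr0.
  exact: ((AE x Ux).1 Ax).
exists (fun t => theta' (a + t *: u)), r; split => //.
- apply: (@C1_comp _ _ _ _ (fun t : R => a + t *: u) theta' _ (theta @` U)).
  + have -> : [set t : R | `|t| < r] = ball (0 : R) r.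
      by rewrite -ball_normE; apply/seteqP; split=> t /=; rewrite sub0r normrN.
    exact: ball_open.
  + by move=> t; exact: Vline.
  + exact: Ck1_line.
  + exact: Cth' 1%N.
- by rewrite scale0r addr0 inv.
- split.
  + by move=> t /Aline/AM.
  + by move=> t /andP[t0 tr]; apply: Aline; rewrite ger0_norm.
  + have dth : differentiable theta' a by exact: (Cth' 1%N).1.
    have dl : differentiable theta' (a + 0 *: u) by rewrite scale0r addr0.
    by have [_ ->] := is_derive_line dl; rewrite scale0r addr0 deriveE.
Qed.

(** In straightening coordinates [A] is a plane, and the second derivative test
    applies to the function expressed in these coordinates. Criticality is only
    asked on the tangent set of [A]: this is all that a tame generator gives. *)
Lemma straightened_isolated m k (M A : set 'rV[R]_m) x U theta theta'
    (f : 'rV[R]_m -> R) :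
  straightens k A x U theta theta' -> A `<=` M -> A x -> smooth_near f x ->
  (forall v, tangent_set M A x v -> 'd f x v = 0) ->
  definite_on (tangent_set M A x) (fun v =>
    quadratic_hessian (f \o theta') (theta x) ('d theta x v)) ->
  \forall y \near x, A y -> f y = f x -> y = x.
Proof.
move=> st AM Ax [D [oD Dx] CD] crit def.
have [[[oU Ux] oV] Cth Cth' inv AE] := st.
set a := theta x; have Va : (theta @` U) a by exists x.
have dth : differentiable theta x by exact: (Cth 1%N).1.
have dth' : differentiable theta' a by exact: (Cth' 1%N).1.
have df : differentiable f (theta' a) by rewrite inv//; exact: (CD 1%N).1.
have [V [aV VD CV]] := straightens_domain st oD Dx.
have C2 : Ck 2 (f \o theta') V := Ck_comp aV.1 VD (CV 2%N) (CD 2%N).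
have thth' u : 'd theta x ('d theta' a u) = u.
  rewrite -[in 'd theta x](inv x Ux).
  apply: diff_left_inverse => //; first by rewrite inv.
  apply: (near_open_eq oV _ Va) => z Vz.
  by have [] := straightens_inverse_point st Vz.
have T_tangent u : coord_plane k u -> tangent_set M A x ('d theta' a u).
  by move=> ku; exact: (straightens_tangent st AM Ax ku).
have def' : definite_on (coord_plane k) (quadratic_hessian (f \o theta') a).
  have nz u : u != 0 -> 'd theta' a u != 0.
    apply: contra_neq => E; apply: etrans (esym (thth' u)) _.
    exact: etrans (congr1 (fun w => 'd theta x w) E) (linear0 ('d theta x)).
  case: def => def; [left|right]; move=> u /T_tangent Tu /nz u0.
    by have := def _ Tu u0; rewrite thth'.
  by have := def _ Tu u0; rewrite thth'.
have scT c u : coord_plane k u -> @coord_plane m k (c *: u).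
  by move=> ku i /ku; rewrite mxE => ->; rewrite mulr0.
have iso : \forall z \near a, coord_plane k (z - a) ->
    f (theta' z) = f (theta' a) -> z = a.
  apply: (definite_isolated aV C2 (@coord_plane_closed m k) scT _ def') => u ku.
  rewrite deriveE; last exact: differentiable_comp.
  rewrite (diff_comp dth' df) /=.
  have -> : 'd f (theta' a) = 'd f x :> (_ -> _) by rewrite inv.
  exact/crit/T_tangent.
have H : \forall y \near x, coord_plane k (theta y - a) ->
    f (theta' (theta y)) = f (theta' a) -> theta y = a.
  exact: (differentiable_continuous dth iso).
near=> y => Ay fy.
have Uy : U y by near: y; exact: open_nbhs_nbhs.
have tha : theta y = a.
  apply: (near H y) => //; last by rewrite !inv.
  move=> i ki; rewrite !mxE ((AE y Uy).1 Ay i ki) ((AE x Ux).1 Ax i ki).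
  by rewrite subr0.
by rewrite -(inv y Uy) tha inv.
Unshelve. all: by end_near. Qed.

(** At a critical point the second derivative transforms as a quadratic form,
    since the second derivative of the change of coordinates is multiplied by
    the vanishing first derivative of the function. *)
Lemma quadratic_hessian_comp m (f : 'rV[R]_m -> R) (g : 'rV[R]_m -> 'rV[R]_m)
    (V O : set 'rV[R]_m) a u :
  open_nbhs a V -> open O -> (forall z, V z -> O (g z)) ->
  Ck 2 g V -> Ck 2 f O -> (forall v, 'd f (g a) v = 0) ->
  quadratic_hessian (f \o g) a u = quadratic_hessian f (g a) ('d g a u).
Proof.
move=> [oV Va] oO VO Cg Cf crit; rewrite /quadratic_hessian.
pose gi i := fun z => ('D_u g z) 0 i.
pose fi i := 'D_(delta_mx 0 i) f \o g.
have dDg z : V z -> differentiable ('D_u g) z by exact: (Cg.2 u).1.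
have dg z : V z -> differentiable g z by exact: Cg.1.
have df z : O z -> differentiable f z by exact: Cf.1.
have dfi i : differentiable (fi i) a.
  by apply: differentiable_comp; [exact: dg|exact/(Cf.2 _).1/VO].
have dgi i : differentiable (gi i) a.
  by apply: differentiable_comp_coord; exact: dDg.
rewrite (@near_eq_derive _ _ _ _ (\sum_(i < m) (gi i * fi i)) a u); last first.
  apply: (near_open_eq oV _ Va) => z Vz.
  rewrite derive_comp_coord ?fct_sumE//; [exact: dg|exact/df/VO].
rewrite derive_sum => [|i]; last first.
  by apply: diff_derivable; exact: differentiableM.
rewrite (derive_derive_dir _ _ oO Cf (VO a Va)); apply: eq_bigr => i _.
rewrite deriveM; [|exact: diff_derivable..].
have fi0 : fi i a = 0 by rewrite /fi /= (deriveE _ (df _ (VO a Va))).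
rewrite fi0; apply: etrans (congr2 +%R erefl (scale0r _)) _; rewrite addr0.
have dDf : differentiable ('D_(delta_mx 0 i) f) (g a).
  exact: (Cf.2 _).1 (VO a Va).
have -> : 'D_u (fi i) a = 'D_('d g a u) ('D_(delta_mx 0 i) f) (g a).
  rewrite (deriveE _ (dfi i)) (diff_comp (dg a Va) dDf).
  exact: esym (deriveE _ dDf).
by rewrite /gi (deriveE _ (dg a Va)).
Qed.

(** When the function is critical in the ambient space, its Hessian can be
    computed before straightening [A]. *)
Lemma critical_isolated m k (M A : set 'rV[R]_m) x U theta theta'
    (f : 'rV[R]_m -> R) :
  straightens k A x U theta theta' -> A `<=` M -> A x -> smooth_near f x ->
  (forall v, 'd f x v = 0) ->
  definite_on (tangent_set M A x) (quadratic_hessian f x) ->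
  \forall y \near x, A y -> f y = f x -> y = x.
Proof.
move=> st AM Ax sf crit def.
apply: (straightened_isolated st AM Ax sf) => [v _|]; first exact: crit.
have [[[oU Ux] oV] Cth Cth' inv AE] := st.
have [D [oD Dx] CD] := sf.
have [V [aV VD CV]] := straightens_domain st oD Dx.
have hE v : quadratic_hessian (f \o theta') (theta x) ('d theta x v) =
    quadratic_hessian f x v.
  have crit' w : 'd f (theta' (theta x)) w = 0 by rewrite inv.
  rewrite (quadratic_hessian_comp _ aV oD VD (CV 2%N) (CD 2%N) crit').
  apply: (congr2 (quadratic_hessian f) (inv x Ux)); apply: diff_left_inverse.
  - exact: (Cth 1%N).1.
  - exact: (CV 1%N).1 aV.2.
  - exact: near_open_eq oU inv Ux.
by case: def => def; [left|right]; move=> v Tv v0; rewrite hE; exact: def.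
Qed.

End Isolated.

(** * Noether's theorem *)

Section Conservation.
Context {R : realType}.

Lemma scaled_time (a b s t : R) :
  a < 0 < b -> a < t < b -> 0 <= s <= 1 -> a < s * t < b.
Proof.
move=> /andP[a0 b0] /andP[at_ tb] /andP[s0 s1].
have [t0|/ltW t0] := leP 0 t; apply/andP; split.
- by apply: lt_le_trans a0 _; exact: mulr_ge0.
- by apply: le_lt_trans tb; exact: ler_piMl.
- by apply: lt_le_trans at_ _; exact: ler_niMl.
- by apply: le_lt_trans b0; exact: mulr_ge0_le0.
Qed.

Lemma chart_img n (M : manifold R n) (p : M) :
  (chart p @` chart_dom p) (chart p p).
Proof. by exists p => //; exact: (chart_dom_nbhs p).2. Qed.

Lemma chartKp n (M : manifold R n) (p : M) : chart_inv p (chart p p) = p.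
Proof. by rewrite chartK//; exact: (chart_dom_nbhs p).2. Qed.

Lemma near_chartK n (M : manifold R n) (p : M) :
  \forall q \near p, chart_inv p (chart p q) = q.
Proof.
apply: filterS (@chartK _ _ _ p) _; exact: open_nbhs_nbhs (chart_dom_nbhs p).
Qed.

Lemma chart_cont n (M : manifold R n) (p : M) : {for p, continuous (chart p)}.
Proof. by apply: chart_continuous; exact: (chart_dom_nbhs p).2. Qed.

Lemma chart_inv_cont n (M : manifold R n) (p : M) :
  chart_inv p x @[x --> chart p p] --> p.
Proof.
have := chart_inv_continuous (chart_img p).
by rewrite /prop_for /continuous_at chartKp.
Qed.

Lemma smooth_near_differentiable (V W : normedModType R) (f : V -> W) x :
  smooth_near f x -> differentiable f x.
Proof. by move=> [U [_ Ux] Cf]; exact: (Cf 1%N).1. Qed.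

Lemma smooth_function_continuous n (M : manifold R n) (W : normedModType R)
    (f : M -> W) : smooth_function f -> continuous f.
Proof.
move=> sf p; have df := smooth_near_differentiable (sf p).
have cf : {for p, continuous (f \o chart_inv p \o chart p)}.
  apply: continuous_comp; first exact: chart_cont.
  exact: differentiable_continuous.
rewrite /prop_for /continuous_at /= chartKp in cf.
apply: cvg_trans cf; apply: near_eq_cvg; apply: filterS (near_chartK p) => q /=.
by move=> ->.
Qed.

Lemma smooth_J_along n d (M : manifold R n) (J : M -> 'rV[R]_d) xi :
  smooth_function J -> smooth_function (J_along J xi).
Proof.
move=> sJ p; have [U [oU Up] CJ] := sJ p; exists U => // k.
apply: Ck_sum => // i; apply: Ck_mul => //; last exact: Ck_cst.
exact: Ck_coord (CJ k).
Qed.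

Lemma is_derive_along_curve n (M : manifold R n) (f : M -> R) (c : R -> M) s v :
  smooth_function f -> {for s, continuous c} ->
  is_derive s 1 (chart (c s) \o c : R -> 'rV[R]_n) v ->
  is_derive s 1 (f \o c) (dfun f (c s) v).
Proof.
move=> sf cc [dc dcv]; have df := smooth_near_differentiable (sf (c s)).
have dcs : differentiable (chart (c s) \o c) s by exact/derivable1_diffP.
have dfc := differentiable_comp dcs df.
apply: (@near_eq_is_derive _ _ _ (f \o chart_inv (c s) \o (chart (c s) \o c))).
  have : \forall t \near s, chart_inv (c s) (chart (c s) (c t)) = c t.
    exact: cc _ (near_chartK (c s)).
  by apply: filterS => t /= ->.
apply: DeriveDef; first exact: diff_derivable.
by rewrite deriveE// diff_comp//= -(deriveE _ dcs) dcv.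
Qed.

(** Reparametrizing by [u |-> u * t] on the unit interval treats positive and
    negative times at once. *)
Lemma constant_along_flow n (M : manifold R n) (X : M -> 'rV[R]_n) (f : M -> R)
    (a b : R) (c : R -> M) :
  smooth_function f -> (forall q, dfun f q (X q) = 0) -> a < 0 < b ->
  (forall s, a < s < b -> {for s, continuous c} /\
     is_derive s 1 (chart (c s) \o c : R -> 'rV[R]_n) (X (c s))) ->
  forall t, a < t < b -> f (c t) = f (c 0).
Proof.
move=> sf fX ab cP t tab.
pose g (u : R) := (f \o c) (0 + u *: t).
have dg (u : R) : 0 <= u <= 1 -> is_derive u 1 g 0.
  move=> u01; have ut : a < 0 + u *: t < b by rewrite add0r; exact: scaled_time.
  have [cc dc] := cP _ ut.
  have := is_derive_along_curve sf cc dc; rewrite fX => -[ex D0].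
  have dfc : differentiable (f \o c) (0 + u *: t) by exact/derivable1_diffP.
  have D0t y : 'd (f \o c) y t = t * 'd (f \o c) y 1.
    by rewrite -{1}(mulr1 t); exact: linearZ_LR.
  have := is_derive_line dfc.
  by rewrite (deriveE t dfc) D0t -(deriveE (1 : R) dfc) D0 mulr0.
have [e _] := mvt0 ltr01 dg.
by rewrite /g /= !add0r scale1r scale0r mul0r => /eqP; rewrite subr_eq0 => /eqP.
Qed.

End Conservation.

Section Noether.
Context {R : realType} {n d : nat} {P : manifold R n} {G : lieGroup R d}.
Variables (omega : P -> 'rV[R]_n -> 'rV[R]_n -> R) (act : G -> P -> P).

(** A nondegenerate form identifies vectors and covectors in finite dimension;
    hence the Hamiltonian vector field, obtained by choice, does satisfy its
    defining equation. *)
Lemma form_represents (p : P) (phi : {linear 'rV[R]_n -> R}) :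
  symplectic_form omega -> exists X, forall v, omega p X v = phi v.
Proof.
move=> [lin alt nd _ _].
have w0 v : omega p 0 v = 0.
  have /eqP := lin p 1 0 0 v; rewrite scaler0 addr0 mul1r -subr_eq subrr.
  by move=> /eqP.
have wl u v : omega p u v = \sum_i u 0 i * omega p (delta_mx 0 i) v.
  have {1}-> : u = \sum_(i < n) u 0 i *: delta_mx 0 i by exact: row_sum_delta.
  elim/big_rec2: _ => // i a b _ <-; exact: lin.
have wr u v : omega p u v = \sum_j v 0 j * omega p u (delta_mx 0 j).
  rewrite alt wl -sumrN; apply: eq_bigr => j _.
  by rewrite -mulrN -alt.
pose M := \matrix_(i < n, j < n) omega p (delta_mx 0 i) (delta_mx 0 j).
have MP (u : 'rV[R]_n) j : (u *m M) 0 j = omega p u (delta_mx 0 j).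
  by rewrite mxE wl; apply: eq_bigr => i _; rewrite mxE.
have Munit : M \in unitmx.
  rewrite -row_free_unit -kermx_eq0; apply/eqP/row_matrixP => i; rewrite row0.
  apply: (nd p) => v; rewrite wr big1// => j _.
  by rewrite -MP -row_mul mulmx_ker row0 mxE mulr0.
exists ((\row_j phi (delta_mx 0 j)) *m invmx M) => v.
rewrite wr {2}(row_sum_delta v) linear_sum; apply: eq_bigr => j _.
by rewrite -MP mulmxKV// mxE linearZ_LR.
Qed.

Lemma hamiltonian_vfP (f : P -> R) p v :
  symplectic_form omega -> omega p (hamiltonian_vf omega f p) v = dfun f p v.
Proof.
move=> sw; have [X HX] := form_represents p ('d (f \o chart_inv p) (chart p p)) sw.
by have := @getPex _ [set X : 'rV[R]_n | forall v, omega p X v = dfun f p v]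
  (ex_intro _ X HX); exact.
Qed.

(** The infinitesimal action at [p] is the derivative at the identity of the
    orbit map [g |-> g p], along which an invariant function is constant. *)
Lemma dfun_infinitesimal_action (f : P -> R) p xi :
  lie_action act -> smooth_function f -> invariant_function act f ->
  dfun f p (infinitesimal_action act xi p) = 0.
Proof.
move=> [sact a1 aM] sf fi.
pose o := lone G; pose x0 := chart o o.
pose h := chart (act o p) \o act^~ p \o chart_inv o.
have [cact [U [oU Ux] CU]] := sact o p.
have dh : differentiable h x0.
  pose k (z : 'rV[R]_d * 'rV[R]_n) :=
    chart (act o p) (act (chart_inv o z.1) (chart_inv p z.2)).
  have -> : h = k \o (fun x => (x, chart p p)).
    by apply/funext => x; rewrite /h /k /= chartKp.
  apply: differentiable_comp; last exact: (CU 1%N).1.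
  by apply: differentiable_pair => //; exact: differentiable_cst.
have hx0 : h x0 = chart (act o p) (act o p) by rewrite /h /= chartKp.
have df : differentiable (f \o chart_inv (act o p)) (h x0).
  by rewrite hx0; exact: smooth_near_differentiable.
have d0 : 'd ((f \o chart_inv (act o p)) \o h) x0 xi = 0.
  have E : \forall x \near x0, cst (f p) x = ((f \o chart_inv (act o p)) \o h) x.
    have cx : (fun x => act (chart_inv o x) p) x @[x --> x0] --> act o p.
      apply: (@cvg_comp _ _ _ (fun x => (chart_inv o x, p))
        (fun z : G * P => act z.1 z.2) _ (nbhs (o, p))); last exact: cact.
      have Fx : Filter (nbhs x0) by exact: nbhs_filter.
      by apply: (cvg_pair (F := nbhs x0)); [exact: chart_inv_cont|exact: cvg_cst].
    have : \forall x \near x0, chart_inv (act o p) (chart (act o p)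
        (act (chart_inv o x) p)) = act (chart_inv o x) p.
      exact: cx _ (near_chartK (act o p)).
    apply: filterS => x /= ->.
    by rewrite fi.
  by rewrite (near_eq_diff E) ?diff_cst//; exact: differentiable_cst.
rewrite (diff_comp dh df) in d0.
have -> : dfun f p = dfun f (act o p) by rewrite /o a1.
have -> : dfun f (act o p) = 'd (f \o chart_inv (act o p)) (h x0) by rewrite hx0.
exact: d0.
Qed.

End Noether.

(** * Topology of manifolds, proper actions and slices *)

Section ManifoldTopology.
Context {R : realType}.

Lemma norm_ball_compact m (x : 'rV[R]_m) (r : R) :
  compact [set y | `|x - y| <= r].
Proof.
apply: bounded_closed_compact.
  exists (`|x| + r); split; first exact: num_real.
  move=> M M1 u /= ur; apply: le_trans (ltW M1).
  have -> : u = x - (x - u) by rewrite subKr.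
  by apply: le_trans (ler_normB _ _) _; rewrite lerD2l.
apply: (@preimage_closed _ _ (fun y : 'rV[R]_m => `|x - y|) [set t | t <= r]).
  move=> y _; apply: (@cvg_norm _ _ _ (nbhs y)).
  by apply: (@cvgB _ _ _ (nbhs y)); [exact: cvg_cst|exact: cvg_id].
exact: closed_le.
Qed.

Lemma manifold_compact_nbhs n (M : manifold R n) (p : M) (U : set M) :
  nbhs p U -> exists K K' : set M,
    [/\ compact K, open_nbhs p K', K' `<=` K & K `<=` U].
Proof.
move=> pU; pose x := chart p p.
have [r /= r0 ballr] : nbhs_ball x
    ((chart p @` chart_dom p) `&` chart_inv p @^-1` U).
  apply/nbhs_ballP; apply: filterI; last exact: (chart_inv_cont pU).
  by apply: open_nbhs_nbhs; split; [exact: chart_img_open|exact: chart_img].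
have cb y : `|x - y| <= r / 2 -> ((chart p @` chart_dom p) `&` chart_inv p @^-1` U) y.
  move=> xy; apply: ballr; rewrite -ball_normE /=.
  by apply: le_lt_trans xy _; rewrite ltr_pdivrMr// mulr_natr mulr2n ltrDl.
exists (chart_inv p @` [set y | `|x - y| <= r / 2]).
exists (chart_dom p `&` chart p @^-1` ball x (r / 2)).
split.
- apply: continuous_compact; last exact: norm_ball_compact.
  by apply: continuous_within => y /cb[yimg _]; exact: chart_inv_continuous.
- split.
    apply: open_setI_preimage; [exact: (chart_dom_nbhs p).1|exact: ball_open|].
    by move=> q; exact: chart_continuous.
  split; first exact: (chart_dom_nbhs p).2.
  by apply: ballxx; rewrite divr_gt0.
- move=> q [qp]; rewrite -ball_normE /= => /ltW xq.
  by exists (chart p q) => //; exact: chartK.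
- by move=> _ [y /= /cb[_ Uy] <-].
Qed.

(** The part of a submanifold in a small compact set is therefore compact, as
    it is the trace of its closure. *)
Lemma submanifold_locally_closed n (M : manifold R n) (S : set M) p :
  submanifold S -> S p ->
  \forall q \near p, closure S q -> S q.
Proof.
move=> [k subm] Sp.
have [_ [U [theta [theta' [[[oU Ux] _] Cth _ _ AE]]]]] := subm p Sp.
pose O := chart_dom p `&` chart p @^-1` U.
have oO : open O.
  apply: open_setI_preimage => //; first exact: (chart_dom_nbhs p).1.
  by move=> q; exact: chart_continuous.
have OE q : O q ->
    S q <-> forall i : 'I_n, (k <= i)%N -> theta (chart p q) 0 i = 0.
  move=> [qp Uq]; rewrite -(AE _ Uq) /in_chart /= chartK//; split; last by case.
  by split=> //; exists q.
have pO : nbhs p O.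
  by apply: open_nbhs_nbhs; split=> //; split=> //; exact: (chart_dom_nbhs p).2.
apply: filterS pO => q Oq clSq; apply/(OE q Oq) => i ki; apply/eqP.
apply: contraT => thi.
pose f q' := theta (chart p q') 0 i.
have cf q' : O q' -> {for q', continuous f}.
  move=> [qp Uq]; apply: (@continuous_comp _ _ _ (theta \o chart p)
      (fun u : 'rV[R]_n => u 0 i)); last exact: coord_continuous.
  apply: continuous_comp; first exact: chart_continuous.
  exact: (Cth 0%N).
have oN : open (O `&` f @^-1` [set t | t != 0]).
  by apply: open_setI_preimage => //; exact: open_neq.
have [|z [Sz [Oz /eqP]]] := clSq (O `&` f @^-1` [set t | t != 0]).
  by apply: open_nbhs_nbhs; split.
by case; apply: ((OE z Oz).1 Sz).
Qed.

Lemma smooth_map2_continuous l m n (L : manifold R l) (M : manifold R m)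
    (N : manifold R n) (f : L -> M -> N) :
  smooth_map2 f -> continuous (fun z : L * M => f z.1 z.2).
Proof. by move=> sf [p q]; have [] := sf p q. Qed.

(** Near [y] the saturation is the image under the action of the set of pairs
    [(g, s)] with [s] in [L] and [g s] in a compact neighbourhood of [y], which
    properness makes compact. *)
Lemma proper_saturation_closed n d (P : manifold R n) (G : lieGroup R d)
    (act : G -> P -> P) (L : set P) :
  smooth_map2 act -> proper_action act -> compact L ->
  closed (saturation act L).
Proof.
move=> /smooth_map2_continuous cact prop cL y cly.
have [N [N' [cN yN' N'N _]]] := manifold_compact_nbhs (@filterT _ (nbhs y) _).
have hP := @manifold_hausdorff _ _ P.
pose Q := (fun z : G * P => (z.2, act z.1 z.2)) @^-1` (L `*` N).
have cQ : compact Q := prop _ (compact_setX cL cN).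
have cI : compact ((fun z : G * P => act z.1 z.2) @` Q).
  by apply: continuous_compact cQ; exact: continuous_subspaceT.
have clI := compact_closed hP cI.
have : ((fun z : G * P => act z.1 z.2) @` Q) y.
  apply: clI => W yW.
  have [z [[g _ [s Ls <-]] [Wz Nz]]] := cly _ (filterI yW (open_nbhs_nbhs yN')).
  exists (act g s); split=> //; exists (g, s) => //.
  by split=> //=; exact: N'N.
by move=> [[g s] [/= Ls _] <-]; exists g => //; exists s.
Qed.

End ManifoldTopology.

(** * Stability from isolation on the non-separated set *)

Section Stability.
Context {R : realType} {n d : nat} {P : manifold R n} {G : lieGroup R d}.
Variables (omega : P -> 'rV[R]_n -> 'rV[R]_n -> R) (act : G -> P -> P)
  (J : P -> 'rV[R]_d) (H : P -> R).

(** Noether: [dJ_xi (X_H) = omega (xi p, X_H) = - dH (xi p) = 0]. *)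
Lemma momentum_conserved xi p :
  symplectic_form omega -> lie_action act ->
  equivariant_momentum_map act omega J ->
  smooth_function H -> invariant_function act H ->
  dfun (J_along J xi) p (hamiltonian_vf omega H p) = 0.
Proof.
move=> sw la [_ mom _] sH iH.
rewrite -mom (form_alternating sw) hamiltonian_vfP//.
by rewrite (dfun_infinitesimal_action _ _ la sH iH) oppr0.
Qed.

(** Trajectories are parametrized by the unit interval, which covers forward
    and backward times at once. *)
Lemma flow_conserved t p q :
  symplectic_form omega -> lie_action act ->
  equivariant_momentum_map act omega J ->
  smooth_function H -> invariant_function act H ->
  flow (hamiltonian_vf omega H) t p q ->
  exists gam : R -> P,
    [/\ forall s, 0 <= s <= 1 -> {for s, continuous gam},
        gam 0 = p, gam 1 = q &
        forall s, 0 <= s <= 1 -> H (gam s) = H p /\ J (gam s) = J p].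
Proof.
move=> sw la mom sH iH [a [b [c [ab tab c0 ct cP]]]].
have st s : 0 <= s <= 1 -> a < s * t < b by exact: scaled_time.
exists (fun s => c (s * t)); split.
- move=> s /st/cP[cc _].
  by apply: (@continuous_comp _ _ _ (fun s : R => s * t) c) => //; exact: mulrr_continuous.
- by rewrite mul0r.
- by rewrite mul1r.
- move=> s /st sab; split.
    (* [dH (X_H) = omega (X_H, X_H)] vanishes, the form being alternating. *)
    rewrite -c0; apply: (constant_along_flow sH _ ab cP sab) => r.
    have := hamiltonian_vfP H r (hamiltonian_vf omega H r) sw => <-.
    apply/eqP; rewrite -[_ == 0](mulrn_eq0 _ 2) mulr2n addr_eq0.
    by rewrite -(form_alternating sw).
  rewrite -c0; apply/rowP => i.
  have sJ := smooth_J_along (delta_mx 0 i) (momentum_smooth mom).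
  have JE r : J_along J (delta_mx 0 i) r = J r 0 i.
    rewrite /J_along /pairing (bigD1 i)//= mxE !eqxx mulr1 big1 ?addr0// => j ji.
    by rewrite mxE (negbTE ji) andbF mulr0.
  rewrite -!JE; apply: (constant_along_flow sJ _ ab cP sab) => r.
  exact: momentum_conserved.
Qed.

(** The first exit time is needed, and not just some
    point of the path on the boundary of [W], so that the whole path up to it
    can be projected to the slice. *)
Lemma first_exit (T : topologicalType) (gam : R -> T) (W : set T) :
  (forall s, 0 <= s <= 1 -> {for s, continuous gam}) ->
  open W -> W (gam 0) -> ~ W (gam 1) ->
  exists tau : R, [/\ 0 < tau <= 1, ~ W (gam tau), closure W (gam tau) &
    forall s, 0 <= s < tau -> W (gam s)].
Proof.
move=> cg oW W0 W1.
pose F := [set s : R | 0 <= s <= 1 /\ ~ W (gam s)].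
have F1 : F 1 by split=> //; rewrite ler01 lexx.
have lbF : lbound F 0 by move=> s [/andP[]].
have hF : has_inf F by split; [exists 1|exists 0].
set tau := inf F.
have tau0 : 0 <= tau by apply: lb_le_inf; [exists 1|].
have tau1 : tau <= 1 by apply: ge_inf => //; exists 0.
have before s : 0 <= s < tau -> W (gam s).
  move=> /andP[s0 st]; apply: contrapT => Ws.
  have : tau <= s.
    apply: ge_inf; first by exists 0.
    by split=> //; rewrite s0 (le_trans (ltW st)).
  by rewrite leNgt st.
have Wtau : ~ W (gam tau).
  move=> Wt.
  have /nbhs_ballP[e /= e0 be] : nbhs tau (gam @^-1` W).
    by apply: (cg tau); [rewrite tau0|exact: open_nbhs_nbhs].
  have [s Fs] := inf_adherent e0 hF; rewrite -/tau => st.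
  have ts : tau <= s by apply: ge_inf => //; exists 0.
  apply: Fs.2; apply: be; rewrite -ball_normE /= ler0_norm ?subr_le0//.
  by rewrite opprB ltrBlDr addrC.
have taup : 0 < tau.
  by rewrite lt_neqAle tau0 andbT; apply/eqP => t0; apply: Wtau; rewrite -t0.
exists tau; split=> //; first by rewrite taup.
move=> N tN.
have /nbhs_ballP[e /= e0 be] : nbhs tau (gam @^-1` N).
  by apply: (cg tau); rewrite ?tau0.
pose s := Num.max 0 (tau - e / 2).
have s0 : 0 <= s by rewrite le_max lexx.
have stau : s < tau by rewrite gt_max taup gtrBl divr_gt0.
exists (gam s); split; first by apply: before; rewrite s0.
apply: be; rewrite -ball_normE /= gtr0_norm ?subr_gt0// ltrBlDr -ltrBlDl.
by rewrite lt_max ltrD2l ltrN2 gtr_pMr// invf_lt1// ltr1n orbT.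
Qed.

(** If [y] is not in [T2], disjoint leaf-open neighbourhoods of [p] and [y]
    exist and no leaf meets both; if it is, [H] takes different values at [p]
    and [y], hence near them. Either way no trajectory, projected to the slice,
    goes from a point close to [p] to a point close to [y]. *)
Lemma leaf_separated (S : set P) (p y : P) :
  continuous H -> S y -> (T2 G J S p y -> H y <> H p) ->
  \forall x' \near y & x \near p,
    S x -> S x' -> H x = H x' -> same_leaf G J S x x' -> False.
Proof.
move=> cH Sy HT2.
have [T2y|nT2y] := pselect (T2 G J S p y).
  have /eqP Hpy := HT2 T2y.
  have := @norm_hausdorff R R^o; rewrite open_hausdorff => /(_ _ _ Hpy).
  move=> [[A B] /= [/set_mem yA /set_mem pB] [oA oB AB]].
  exists (H @^-1` A, H @^-1` B) => [|[x' x] /= [Ax' Bx] _ _ Hx _].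
    by split; apply: cH; exact: open_nbhs_nbhs.
  have : (A `&` B) (H x') by split=> //; rewrite -Hx.
  by rewrite (eqP AB).
have [W [W' [[[D oD WD] Wsat] [[D' oD' WD'] W'sat] Wp W'y WW']]] :
    exists W W', [/\ leaf_open G J S W, leaf_open G J S W', W p, W' y &
      W `&` W' = set0].
  apply: contrapT => nex; apply: nT2y; split=> // W W' lW lW' Wp W'y.
  apply: contrapT => WW'; apply: nex; exists W, W'; split=> //.
  by apply: contrapT => /eqP/set0P.
exists (D', D) => [|[x' x] /= [Dx' Dx] Sx Sx' _ lf].
  by split; apply: open_nbhs_nbhs; split=> //;
    [move: W'y; rewrite WD' => -[]|move: Wp; rewrite WD => -[]].
have : (W `&` W') x'.
  split; last by rewrite WD'.
  by apply: (Wsat x) => //; rewrite WD.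
by rewrite WW'.
Qed.

(** The projection of a trajectory to the slice moves each of its points by a
    group element, which by equivariance keeps the momentum in one coadjoint
    orbit; so it stays in one leaf. *)
Lemma slice_path_same_leaf (S : set P) (r : P -> P) (gam : R -> P) (tau : R) :
  lie_action act -> equivariant_momentum_map act omega J ->
  (forall g s, S s -> r (act g s) = s) ->
  (forall q, saturation act S q -> {for q, continuous r}) ->
  0 <= tau ->
  (forall s, 0 <= s <= tau -> {for s, continuous gam}) ->
  (forall s, 0 <= s <= tau -> saturation act S (gam s)) ->
  (forall s, 0 <= s <= tau -> J (gam s) = J (gam 0)) ->
  same_leaf G J S (r (gam 0)) (r (gam tau)).
Proof.
move=> la mom rS cr tau0 cg Sg Jg.
have tt (t : R) : 0 <= t <= 1 -> 0 <= t * tau <= tau.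
  by move=> /andP[t0 t1]; rewrite mulr_ge0//= ler_piMl.
exists (fun t => r (gam (t * tau))); split.
- apply: continuous_within => t; rewrite /= in_itv /= => /tt ht.
  apply: (@continuous_comp _ _ _ (fun t : R => gam (t * tau)) r).
    apply: (@continuous_comp _ _ _ (fun t : R => t * tau) gam).
      exact: mulrr_continuous.
    exact: cg.
  exact/cr/Sg.
- by rewrite mul0r.
- by rewrite mul1r.
- move=> t /tt ht.
  have [g _ [s Ss E]] := Sg _ ht.
  have [g0 _ [s0 Ss0 E0]] : saturation act S (gam 0) by apply: Sg; rewrite lexx.
  have Jt := Jg _ ht; rewrite -E -E0 in Jt *.
  rewrite /= !rS//; split=> //.
  exists (lmul (linv g) g0) => //; rewrite /= -(momentum_equivariant mom) (actM la).
  rewrite (momentum_equivariant mom) -Jt -(momentum_equivariant mom) -(actM la).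
  by rewrite lmulV (act1 la).
Qed.

(** If a trajectory starting near the group orbit left a small neighbourhood of
    it, its projection to the slice would reach a compact sphere around [p]
    inside the leaf where it started, and at the same value of [H]; but every
    point of that sphere is dynamically separated from [p], hence, by
    compactness, so is a whole neighbourhood of [p]. *)
Lemma stable_of_isolated (S : set P) (p : P) :
  symplectic_form omega -> lie_action act -> proper_action act ->
  equivariant_momentum_map act omega J ->
  smooth_function H -> invariant_function act H -> slice act S p ->
  (\forall y \near p, T2 G J S p y -> H y = H p -> y = p) ->
  G_stable act omega H p.
Proof.
move=> sw la prop mom sH iH slS iso U pU Uinv.
have [subm Sp _ _ oS [r [rS smr]]] := slS.
have cr q : saturation act S q -> {for q, continuous r} by move=> /smr[].
have [K [K' [cK [oK' K'p] K'K KU]]] := manifold_compact_nbhs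
  (filterI pU (filterI iso (submanifold_locally_closed subm Sp))).
have cL : compact (K `&` S).
  have -> : K `&` S = K `&` closure S.
    apply/seteqP; split=> q [Kq].
      by move=> Sq; split=> //; exact: subset_closure.
    by move=> clq; split=> //; have [_ [_]] := KU q Kq; exact.
  by apply: compact_closedI => //; exact: closed_closure.
have satS s : S s -> saturation act S s.
  by move=> Ss; exists (lone G) => //; exists s => //; rewrite (act1 la).
have rp : r p = p by rewrite -{1}(act1 la p) rS.
pose bd := (K `&` S) `&` ~` K'.
have cbd : compact bd by apply: compact_closedI => //; exact: open_closedC.
have cH := smooth_function_continuous sH.
have sep : \forall x \near p, bd `<=` [set x' |
    S x -> S x' -> H x = H x' -> same_leaf G J S x x' -> False].
  have /compact_near_coveringP cov := cbd.
  apply: (cov _ (nbhs p) (fun x x' => S x -> S x' -> H x = H x' ->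
    same_leaf G J S x x' -> False)) => y [[Ky Sy] nK'y].
  apply: leaf_separated => // T2y Hy; apply: nK'y.
  by have [_ [/(_ T2y Hy) -> _]] := KU y Ky.
(* [W] is the tube around the group orbit that trajectories must not leave. *)
pose W := saturation act S `&` r @^-1` K'.
have oW : open W by apply: open_setI_preimage.
have WE q : W q -> saturation act (K `&` S) q.
  move=> [[g _ [s Ss <-]]]; rewrite /= rS// => K's.
  by exists g => //; exists s => //; split=> //; exact: K'K.
exists (W `&` r @^-1` [set x | bd `<=` [set x' |
    S x -> S x' -> H x = H x' -> same_leaf G J S x x' -> False]]).
  have cp := cr p (satS p Sp); apply: filterI.
    by apply: open_nbhs_nbhs; split=> //; split; [exact: satS|rewrite /= rp].
  by apply: cp; rewrite rp.
move=> q t q' [Wq sepq] fl.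
suff /WE[g _ [s [Ks _] <-]] : W q'.
  by apply: Uinv; have [] := KU s Ks.
have [gam [cg g0 g1 cons]] := flow_conserved sw la mom sH iH fl.
apply: contrapT => nW.
have [||tau [/andP[tau0 tau1] Wtau clW before]] := first_exit cg oW.
- by rewrite g0.
- by rewrite g1.
have clK : closed (saturation act (K `&` S)).
  exact: proper_saturation_closed (act_smooth la) prop cL.
have [g _ [s [Ks Ss] E]] : saturation act (K `&` S) (gam tau).
  by apply: clK; apply: closure_subset clW; exact: WE.
have rtau : r (gam tau) = s by rewrite -E rS.
have lt1 u : 0 <= u <= tau -> 0 <= u <= 1.
  by move=> /andP[-> ut]; rewrite (le_trans ut).
have Sgam u : 0 <= u <= tau -> saturation act S (gam u).
  move=> /andP[u0]; rewrite le_eqVlt => /orP[/eqP ->|ut].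
    by exists g => //; exists s.
  by apply: (before u _).1; rewrite u0.
have lf : same_leaf G J S (r (gam 0)) (r (gam tau)).
  apply: (slice_path_same_leaf la mom rS cr (ltW tau0)) => // u /lt1 u1.
    exact: cg.
  by rewrite g0; apply: (cons u u1).2.
have Hr u : saturation act S u -> H (r u) = H u.
  by move=> [h _ [x Sx <-]]; rewrite rS// iH.
have Sr u : saturation act S u -> S (r u).
  by move=> [h _ [x Sx <-]]; rewrite rS.
have Sg0 : saturation act S (gam 0) by apply: Sgam; rewrite lexx ltW.
have Sgt : saturation act S (gam tau) by apply: Sgam; rewrite lexx ltW.
have bds : bd (r (gam tau)).
  rewrite rtau; split=> //= K's; apply: Wtau; split=> //=; by rewrite rtau.
rewrite -g0 in sepq.
apply: (sepq _ bds (Sr _ Sg0) (Sr _ Sgt) _ lf).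
have [Htau _] : H (gam tau) = H q /\ J (gam tau) = J q by apply: cons; rewrite ltW.
by rewrite (Hr _ Sg0) (Hr _ Sgt) Htau g0.
Qed.

End Stability.

(** * Casimirs and tame generators *)

Section Tame.
Context {R : realType}.

Lemma derive1_right_constant (h : R -> R) (e : R) : 0 < e ->
  derivable h 0 1 -> (forall t, 0 <= t < e -> h t = h 0) -> 'D_1 h 0 = 0.
Proof.
move=> e0 dh hc; rewrite /derive cvg_at_rightE; last exact: dh.
apply: cvg_lim => //.
apply: (@cvg_trans _ (cst (0 : R) @ (0 : R)^'+)); last exact: cvg_cst.
apply: near_eq_cvg; near=> t.
have t0 : 0 < t by near: t; exact: nbhs_right_gt.
have te : t < e by near: t; exact: nbhs_right_lt.
have tE : t *: (1 : R) + 0 = t by rewrite addr0; exact: mulr1.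
by rewrite /= tE hc ?subrr ?scaler0// ltW.
Unshelve. all: by end_near. Qed.

Lemma smooth_nearD (V W : normedModType R) (f g : V -> W) x :
  smooth_near f x -> smooth_near g x -> smooth_near (fun y => f y + g y) x.
Proof.
move=> [U [oU Ux] Cf] [U' [oU' Ux'] Cg]; exists (U `&` U').
  by split; [exact: openI|].
move=> k; apply: Ck_add; first exact: openI.
  exact: Ck_sub (@subIsetl _ _ _) (Cf k).
exact: Ck_sub (@subIsetr _ _ _) (Cg k).
Qed.

Lemma smooth_nearN (V : normedModType R) (f : V -> R) x :
  smooth_near f x -> smooth_near (fun y => - f y) x.
Proof.
move=> [U [oU Ux] Cf]; exists U => // k.
have := Ck_mul oU (Ck_cst k (-1 : R) U) (Cf k).
by apply: (Ck_eq oU) => y _; exact: mulN1r.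
Qed.

Lemma smooth_near_comp (V : normedModType R) m (g : V -> 'rV[R]_m)
    (f : 'rV[R]_m -> R) (U : set 'rV[R]_m) x :
  smooth_near g x -> open_nbhs (g x) U -> smooth_on f U ->
  smooth_near (f \o g) x.
Proof.
move=> [V' [oV Vx] Cg] [oU Ugx] Cf.
have oD : open (V' `&` g @^-1` U).
  by apply: open_setI_preimage => //; exact: (Cg 0%N).
exists (V' `&` g @^-1` U) => // k.
apply: (Ck_comp oD _ (Ck_sub (@subIsetl _ _ _) (Cg k)) (Cf k)) => y [].
by [].
Qed.

Lemma isolated_in_chart n (P : manifold R n) (f : P -> R) (A : set P) p :
  (\forall x \near chart p p, in_chart p A x ->
     (f \o chart_inv p) x = (f \o chart_inv p) (chart p p) -> x = chart p p) ->
  \forall y \near p, A y -> f y = f p -> y = p.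
Proof.
move=> iso; have {}iso : \forall y \near p, in_chart p A (chart p y) ->
    f (chart_inv p (chart p y)) = f p -> chart p y = chart p p.
  by have := chart_cont iso; rewrite /= chartKp.
near=> y => Ay fy.
have py : chart_dom p y.
  by near: y; exact: open_nbhs_nbhs (chart_dom_nbhs p).
rewrite -(chartK py) -[RHS](chartKp p); congr (chart_inv p _).
apply: (near iso y) => //; last by rewrite chartK.
by split; [exists y|rewrite /= chartK].
Unshelve. all: by end_near. Qed.

Lemma in_chart_self n (P : manifold R n) (A : set P) p :
  A p -> in_chart p A (chart p p).
Proof. by move=> Ap; split; [exact: chart_img|rewrite chartKp]. Qed.

Lemma in_chart_sub n (P : manifold R n) (A B : set P) p :
  A `<=` B -> in_chart p A `<=` in_chart p B.
Proof. by move=> AB x [? /AB]. Qed.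

Context {n d : nat} {P : manifold R n} {G : lieGroup R d}.

(** A continuous function that is constant on leaves factors through the leaf
    space, and cannot distinguish points which that space does not separate. *)
Lemma casimir_T2 (U Sigma : set 'rV[R]_d) (mu0 mu nu : 'rV[R]_d) (C : 'rV[R]_d -> R) :
  smooth_local_casimir G mu0 U C -> Sigma `<=` U -> Sigma mu ->
  T2 G id Sigma mu nu -> C nu = C mu.
Proof.
move=> [[oU _] cC lC _] SU Smu [Snu sep]; apply: contrapT => /eqP Cne.
have := @norm_hausdorff R R^o; rewrite open_hausdorff => /(_ _ _ Cne).
move=> [[A B] /= [/set_mem nA /set_mem mB] [oA oB AB]].
have lo D : open D -> leaf_open G id Sigma (Sigma `&` (U `&` C @^-1` D)).
  move=> oD; split.
    by exists (U `&` C @^-1` D) => //; exact: open_setI_preimage.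
  move=> x y [Sx [Ux Dx]] Sy [c [cc c0 c1 cS]]; split=> //; split; first exact: SU.
  rewrite /= -(lC x y) //; first exact: SU.
  by exists c; split=> // t /cS[/SU].
have [||x [[_ [_ Bx]] [_ [_ Ax]]]] := sep _ _ (lo _ oB) (lo _ oA).
- by split=> //; split=> //; exact: SU.
- by split=> //; split=> //; exact: SU.
- by have : (A `&` B) (C x) by []; rewrite (eqP AB).
Qed.

Lemma dfun_relative_equilibrium (omega : P -> 'rV[R]_n -> 'rV[R]_n -> R)
    (act : G -> P -> P) (J : P -> 'rV[R]_d) (H : P -> R) p xi v :
  symplectic_form omega -> equivariant_momentum_map act omega J ->
  relative_equilibrium act omega H p xi ->
  dfun H p v = dfun (J_along J xi) p v.
Proof.
move=> sw mom req; rewrite -(hamiltonian_vfP _ _ _ sw) req.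
exact: momentum_hamiltonian.
Qed.

Variables (J : P -> 'rV[R]_d) (S : set P) (p : P).
Hypotheses (sJ : smooth_function J) (Sp : S p)
  (S_small : T2 G J S p = J @^-1` (T2 G id (J @` S) (J p)) `&` S).

(** The momentum map sends curves in the slice to curves in its image, and by
    hypothesis [T2] into [T2]; tameness is thereby transported to the slice. *)
Lemma momentum_tangent w : mtangent_set S (T2 G J S p) p w ->
  tangent_set (J @` S) (T2 G id (J @` S) (J p)) (J p)
    ('d (J \o chart_inv p) (chart p p) w).
Proof.
move=> [c [e [e0 C1 c0 [cS cT ->]]]].
have [D [oD Dp] CJ] := sJ p.
have c00 : [set t : R | `|t| < e] 0 by rewrite /= normr0.
have cc : {for 0, continuous c} := Ck_continuous C1 c00.
have /nbhs_ballP[r /= r0 br] : nbhs (0 : R) (c @^-1` D).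
  by apply: cc; rewrite c0; exact: open_nbhs_nbhs.
have dc : differentiable c 0 := C1.1 _ c00.
have dJ : differentiable (J \o chart_inv p) (c 0) by rewrite c0; exact: (CJ 1%N).1.
exists ((J \o chart_inv p) \o c), (Num.min e r).
have lte t : `|t| < Num.min e r -> `|t| < e by rewrite lt_min => /andP[].
split.
- by rewrite lt_min e0.
- apply: (C1_comp (O := D)).
  + have -> : [set t : R | `|t| < Num.min e r] = ball (0 : R) (Num.min e r).
      by rewrite -ball_normE; apply/seteqP; split=> t /=; rewrite sub0r normrN.
    exact: ball_open.
  + move=> t /=; rewrite lt_min => /andP[_ tr]; apply: br.
    by rewrite -ball_normE /= sub0r normrN.
  + by apply: Ck_sub C1 => t; exact: lte.
  + exact: (CJ 1%N).
- by rewrite /= c0 chartKp.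
- split.
  + by move=> t /lte/cS[_ Sct]; exists (chart_inv p (c t)).
  + move=> t; rewrite lt_min => /andP[t0 /andP[te _]].
    have [|_] := cT t; first by rewrite t0.
    by rewrite S_small => -[].
  + rewrite (deriveE _ (differentiable_comp dc dJ)) (diff_comp dc dJ) /=.
    by rewrite -(deriveE _ dc) c0.
Qed.

Lemma dfun_J_along xi v :
  dfun (J_along J xi) p v = pairing ('d (J \o chart_inv p) (chart p p) v) xi.
Proof.
have dJ : differentiable (J \o chart_inv p) (chart p p).
  exact: smooth_near_differentiable.
have dJx := smooth_near_differentiable (smooth_J_along xi sJ p).
rewrite /dfun -(deriveE _ dJx) -(deriveE _ dJ).
pose Ji i := fun x => (J (chart_inv p x)) 0 i.
have dJi i : derivable (Ji i) (chart p p) v.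
  by apply: diff_derivable; exact: (differentiable_comp_coord i dJ).
have -> : J_along J xi \o chart_inv p = \sum_(i < d) (xi 0 i *: Ji i).
  apply/funext => x; rewrite fct_sumE; apply: eq_bigr => i _.
  exact: mulrC.
rewrite derive_sum => [|i]; last exact: derivableZ.
apply: eq_bigr => i _; rewrite deriveZ// mulrC; congr (_ * _).
by rewrite (derive_coord _ (diff_derivable dJ)).
Qed.

(** Along a curve in [T2] the Casimir is constant for nonnegative times only,
    but a one-sided derivative determines the derivative. *)
Lemma dfun_casimir (U : set 'rV[R]_d) (C : 'rV[R]_d -> R) w :
  smooth_local_casimir G (J p) U C -> J @` S `<=` U ->
  mtangent_set S (T2 G J S p) p w -> dfun (C \o J) p w = 0.
Proof.
move=> sC SU [c [e [e0 C1 c0 [cS cT ->]]]].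
have dCJ : differentiable ((C \o J) \o chart_inv p) (c 0).
  rewrite c0; apply: smooth_near_differentiable.
  apply: (smooth_near_comp (sJ p) _ (casimir_smooth sC)).
  by rewrite /= chartKp; exact: casimir_nbhs sC.
have dc : differentiable c 0 by apply: C1.1; rewrite /= normr0.
have dh := differentiable_comp dc dCJ.
have <- : 'D_1 (((C \o J) \o chart_inv p) \o c) 0 =
    dfun (C \o J) p ('D_1 c 0).
  by rewrite (deriveE _ dh) (diff_comp dc dCJ) /= -(deriveE _ dc) c0.
apply: (derive1_right_constant e0); first exact: diff_derivable.
move=> t te; have [_] := cT t te; rewrite S_small => -[/= Tt _].
rewrite c0 chartKp; apply: (casimir_T2 sC SU _ Tt); by exists p.
Qed.

End Tame.

(** * The energy-momentum-Casimir method *)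

Section Method.
Context {R : realType} {n d : nat} {P : manifold R n} {G : lieGroup R d}.
Variables (omega : P -> 'rV[R]_n -> 'rV[R]_n -> R) (act : G -> P -> P)
  (J : P -> 'rV[R]_d) (H : P -> R) (p : P) (xi : 'rV[R]_d) (S B : set P)
  (U : set 'rV[R]_d) (C : 'rV[R]_d -> R).
Hypotheses (sw : symplectic_form omega)
  (mom : equivariant_momentum_map act omega J) (sH : smooth_function H)
  (req : relative_equilibrium act omega H p xi) (Sp : S p)
  (S_small : T2 G J S p = J @^-1` (T2 G id (J @` S) (J p)) `&` S)
  (BS : B `<=` S) (Bp : B p)
  (sC : smooth_local_casimir G (J p) U C) (SU : J @` S `<=` U).

Let sJ := momentum_smooth mom.

Lemma smooth_near_casimir : smooth_near ((C \o J) \o chart_inv p) (chart p p).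
Proof.
apply: (smooth_near_comp (sJ p) _ (casimir_smooth sC)).
by rewrite /= chartKp; exact: casimir_nbhs sC.
Qed.

Lemma casimir_momentum_T2 y : T2 G J S p y -> C (J y) = C (J p).
Proof.
rewrite S_small => -[Ty _]; apply: (casimir_T2 sC SU _ Ty); by exists p.
Qed.

(** On [T_p T2] the differential of [H] is that of [J_xi], which vanishes by
    tameness, and the Casimir contributes nothing; hence [H + C o J] is critical
    along [B], whose tangent space is spanned by [T_p T2]. On [T2] it differs
    from [H] by a constant, so an isolated level point of the one is an isolated
    level point of the other. *)
Lemma tame_isolated :
  tame G (J @` S) (J p) xi ->
  mtangent_set S B p `<=` linear_span (mtangent_set S (T2 G J S p) p) ->
  restricted_hessian_definite (fun q => H q + C (J q)) S B p ->
  \forall y \near p, B y -> T2 G J S p y -> H y = H p -> y = p.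
Proof.
move=> tm Bspan [k [V [theta [theta' [st def]]]]].
pose f q := H q + C (J q).
have sCJ := smooth_near_casimir.
have sf : smooth_near (f \o chart_inv p) (chart p p) := smooth_nearD (sH p) sCJ.
have dH := smooth_near_differentiable (sH p).
have dCJ := smooth_near_differentiable sCJ.
have crit1 w : mtangent_set S (T2 G J S p) p w -> dfun f p w = 0.
  move=> Tw.
  have -> : dfun f p w = dfun H p w + dfun (C \o J) p w.
    rewrite /dfun -[X in _ = X]/(('d (H \o chart_inv p) (chart p p) \+
      'd ((C \o J) \o chart_inv p) (chart p p)) w).
    by rewrite -diffD.
  rewrite (dfun_casimir sJ Sp S_small sC SU Tw) addr0.
  rewrite (dfun_relative_equilibrium _ sw mom req) dfun_J_along//.
  exact/tm/momentum_tangent.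
have crit v : mtangent_set S B p v -> dfun f p v = 0.
  move=> /Bspan[m [a [w [Tw ->]]]]; rewrite /dfun linear_sum big1// => i _.
  by rewrite linearZ_LR; apply: etrans (congr1 _ (crit1 _ (Tw i))) (mulr0 _).
have iso := straightened_isolated st (in_chart_sub (p := p) BS)
  (in_chart_self Bp) sf crit def.
apply: filterS (isolated_in_chart iso) => y yp By Ty Hy; apply: yp => //.
by rewrite /f Hy casimir_momentum_T2.
Qed.

(** Here [H_xi + C o J] is critical at [p] in all directions. On [T2] the
    momentum stays in the affine annihilator of the generator, so that [J_xi] is
    constant there and [H] differs from [H_xi + C o J] by a constant. *)
Lemma very_tame_isolated :
  very_tame G (J @` S) (J p) xi -> submanifold B ->
  (forall v, 'd C (J p) v = 0) ->
  hessian_definite_on (fun q => H q - J_along J xi q + C (J q)) S B p ->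
  \forall y \near p, B y -> T2 G J S p y -> H y = H p -> y = p.
Proof.
move=> vt [k Bsub] dC0 def.
have [_ [V [theta [theta' st]]]] := Bsub p Bp.
pose f q := H q - J_along J xi q + C (J q).
have sCJ := smooth_near_casimir.
have sJx := smooth_J_along xi sJ p.
have sHJ : smooth_near ((fun q => H q - J_along J xi q) \o chart_inv p) (chart p p)
  := smooth_nearD (sH p) (smooth_nearN sJx).
have sf : smooth_near (f \o chart_inv p) (chart p p) := smooth_nearD sHJ sCJ.
have dH := smooth_near_differentiable (sH p).
have dJx := smooth_near_differentiable sJx.
have dJ := smooth_near_differentiable (sJ p).
have crit v : 'd (f \o chart_inv p) (chart p p) v = 0.
  have -> : 'd (f \o chart_inv p) (chart p p) v =
      dfun H p v - dfun (J_along J xi) p v + dfun (C \o J) p v.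
    rewrite /dfun -[RHS]/((('d (H \o chart_inv p) (chart p p) \-
      'd (J_along J xi \o chart_inv p) (chart p p)) \+
      'd ((C \o J) \o chart_inv p) (chart p p)) v).
    rewrite -diffB// -diffD//; last exact: smooth_near_differentiable.
    exact: differentiableB.
  rewrite (dfun_relative_equilibrium _ sw mom req) subrr add0r.
  have [oU Up] := casimir_nbhs sC.
  have dC : differentiable C ((J \o chart_inv p) (chart p p)).
    by rewrite /= chartKp; exact: (casimir_smooth sC 1%N).1.
  rewrite /dfun -[(C \o J) \o _]/(C \o (J \o chart_inv p)) (diff_comp dJ dC) /=.
  by rewrite chartKp.
have iso := critical_isolated st (in_chart_sub (p := p) BS)
  (in_chart_self Bp) sf crit def.
apply: filterS (isolated_in_chart iso) => y yp By Ty Hy; apply: yp => //.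
rewrite /f Hy casimir_momentum_T2//; congr (_ - _ + _).
move: Ty; rewrite S_small => -[/vt]; rewrite /pairing => + _ => E.
apply/eqP; rewrite -subr_eq0 -sumrB; apply/eqP; rewrite -[RHS]E.
by apply: eq_bigr => i _; rewrite !mxE mulrBl.
Qed.

End Method.

Theorem theorem4p15 (R : realType) (n d : nat)
    (P : manifold R n) (omega : P -> 'rV[R]_n -> 'rV[R]_n -> R)
    (G : lieGroup R d) (act : G -> P -> P) (J : P -> 'rV[R]_d) (H : P -> R)
    (p_e : P) (xi_e : 'rV[R]_d) (S : set P) (N : nat) (B : 'I_N -> set P)
    (omega_symplectic : symplectic_form omega)
    (act_lie : lie_action act)
    (act_free : free_action act)
    (act_proper : proper_action act)
    (act_symplectic : symplectic_action act omega)
    (J_momentum : equivariant_momentum_map act omega J)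
    (H_smooth : smooth_function H)
    (H_invariant : invariant_function act H)
    (p_e_equilibrium : relative_equilibrium act omega H p_e xi_e)
    (S_slice : slice act S p_e)
    (Sigma_transversal : orbit_transversal G (J @` S) (J p_e))
    (S_small : T2 G J S p_e = J @^-1` (T2 G id (J @` S) (J p_e)) `&` S)
    (B_smoothing : smoothing_at S (T2 G J S p_e) p_e B) :
  (tame G (J @` S) (J p_e) xi_e ->
   (forall i : 'I_N, exists (U : set 'rV[R]_d) (C : 'rV[R]_d -> R),
      [/\ smooth_local_casimir G (J p_e) U C,
          J @` S `<=` U &
          restricted_hessian_definite (fun p => H p + C (J p)) S (B i) p_e]) ->
   G_stable act omega H p_e) /\
  (very_tame G (J @` S) (J p_e) xi_e ->
   (forall i : 'I_N, exists (U : set 'rV[R]_d) (C : 'rV[R]_d -> R),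
      [/\ smooth_local_casimir G (J p_e) U C,
          J @` S `<=` U,
          (forall v, 'd C (J p_e) v = 0) &
          hessian_definite_on
            (fun p => H p - J_along J xi_e p + C (J p)) S (B i) p_e]) ->
   G_stable act omega H p_e).
Proof.
have [sub_in cover span] := B_smoothing.
have Sp := slice_mem S_slice.
have stable : (forall i : 'I_N, \forall y \near p_e,
    B i y -> T2 G J S p_e y -> H y = H p_e -> y = p_e) ->
    G_stable act omega H p_e.
  move=> iso; apply: (stable_of_isolated omega_symplectic act_lie act_proper
    J_momentum H_smooth H_invariant S_slice).
  have : \forall y \near p_e, forall i : 'I_N,
      B i y -> T2 G J S p_e y -> H y = H p_e -> y = p_e.
    exact: (filter_forall (F := nbhs p_e)).
  apply: filterS => y yi Ty Hy.
  by have [i _ Biy] := cover y Ty; exact: yi i Biy Ty Hy.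
split=> xi_tame Hdef; apply: stable => i; have [Bsub BS Bp] := sub_in i.
  have [U [C [sC SU def]]] := Hdef i.
  exact: (tame_isolated omega_symplectic J_momentum H_smooth p_e_equilibrium
    Sp S_small BS Bp sC SU xi_tame (span i) def).
have [U [C [sC SU dC0 def]]] := Hdef i.
exact: (very_tame_isolated omega_symplectic J_momentum H_smooth p_e_equilibrium
  Sp S_small BS Bp sC SU xi_tame Bsub dC0 def).
Qed.
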